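(* If $u:\Gamma\to\mathbb{R}$ is the viscosity solution of $$r(\mathbf{x})-f(\mathbf{x})\,\|\nabla_\Gamma u(\mathbf{x})\|=0,\quad \mathbf{x}\in\Gamma\setminus\mathcal{T},\qquad u(\mathbf{x})=g(\mathbf{x}),\quad\mathbf{x}\in\mathcal{T},$$ then the constant normal extension $\overline u:T_\epsilon\to\mathbb{R}$, $\overline u(\mathbf{z})=u(P_\Gamma\mathbf{z})$, is the viscosity solution of $$\overline r(\mathbf{z})-\overline f(\mathbf{z})\,\|B(\mathbf{z},\mu)\nabla v(\mathbf{z})\|=0,\quad\mathbf{z}\in T_\epsilon\setminus\overline{\mathcal{T}},\qquad v(\mathbf{z})=\overline g(\mathbf{z}),\quad\mathbf{z}\in\overline{\mathcal{T}}.$$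
   Context: Geometry. Let $n\in\{2,3\}$, let $\Omega\subset\mathbb{R}^n$ be a bounded connected open set with smooth closed boundary $\Gamma=\partial\Omega$. For $\epsilon>0$ let $T_\epsilon=\{\mathbf{z}\in\mathbb{R}^n:\min_{\mathbf{x}\in\Gamma}\|\mathbf{x}-\mathbf{z}\|<\epsilon\}$. Throughout, $\epsilon$ is small enough (smaller than the reach of $\Gamma$) that the closest point map $P_\Gamma:T_\epsilon\to\Gamma$, $P_\Gamma(\mathbf{z})=\arg\min_{\mathbf{y}\in\Gamma}\|\mathbf{z}-\mathbf{y}\|$, is well defined and differentiable. Let $d_\Gamma$ be the signed distance to $\Gamma$ on $T_\epsilon$ (negative in $\Omega$, positive outside $\overline\Omega$), and for $|\eta|<\epsilon$ let $\Gamma_\eta=\{\mathbf{z}\in T_\epsilon: d_\Gamma(\mathbf{z})=\eta\}$ be the parallel surface. $\nabla_\Gamma$ is the surface (tangential) gradient. The tensor $B$. For $\mathbf{z}\in T_\epsilon$ with $\eta=d_\Gamma(\mathbf{z})$, let $\mathbf{t}_1,\mathbf{t}_2$ be orthonormal tangent vectors in the principal curvature directions of $\Gamma_\eta$ at $\mathbf{z}$, $\mathbf{n}$ the unit normal to $\Gamma_\eta$ at $\mathbf{z}$, and $\sigma_1,\sigma_2$ the singular values of the Jacobian $P_\Gamma'(\mathbf{z})$ associated with $\mathbf{t}_1,\mathbf{t}_2$, i.e. $P_\Gamma'(\mathbf{z})=\sigma_1\mathbf{t}_1\otimes\mathbf{t}_1+\sigma_2\mathbf{t}_2\otimes\mathbf{t}_2$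 (with $\sigma_i=1-d_\Gamma(\mathbf{z})\kappa_i(\mathbf{z})>0$, $\kappa_i$ the principal curvatures of $\Gamma_\eta$ at $\mathbf{z}$). For a fixed real number $\mu$, $$B(\mathbf{z},\mu)=\sigma_1^{-1}\mathbf{t}_1\otimes\mathbf{t}_1+\sigma_2^{-1}\mathbf{t}_2\otimes\mathbf{t}_2+\mu\,\mathbf{n}\otimes\mathbf{n}$$ (for $n=2$ there is only $\mathbf{t}_1,\sigma_1$, and the $\mathbf{t}_2$ term is absent). Data. $\mathcal{T}\subset\Gamma$ is closed; $f,r:\Gamma\to\mathbb{R}$ are Lipschitz continuous with $0<F_1\le f\le F_2$ and $0<R_1\le r\le R_2$ for constants $F_i,R_i$; $g:\mathcal{T}\to\mathbb{R}$ is lower semicontinuous with $\min_\mathcal{T}g<\infty$. The extensions are $\overline f(\mathbf{z})=f(P_\Gamma\mathbf{z})$, $\overline r(\mathbf{z})=r(P_\Gamma\mathbf{z})$ for $\mathbf{z}\in T_\epsilon$, $\overline{\mathcal{T}}=\{\mathbf{z}\in T_\epsilon:P_\Gamma\mathbf{z}\in\mathcal{T}\}$, and $\overline g(\mathbf{z})=g(P_\Gamma\mathbf{z})$ for $\mathbf{z}\in\overline{\mathcal{T}}$. Viscosity solutions. For an equation $H(\mathbf{x},\nabla w(\mathbf{x}))=0$ on $M\setminus K$ with $w=h$ on $K$ (here $M=\Gamma$ with the surface gradient, or $M=T_\epsilon$ with the Euclidean gradient), where $H$ is the left-hand side displayed, a continuous function $w:M\to\mathbb{R}$ with $w=h$ on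 $K$ is a viscosity solution if it is a subsolution and a supersolution: for every $\phi\in C^1(M)$ and $\mathbf{x}_0\in M\setminus K$, $H(\mathbf{x}_0,\nabla\phi(\mathbf{x}_0))\ge 0$ whenever $w-\phi$ has a local maximum at $\mathbf{x}_0$ (subsolution), and $H(\mathbf{x}_0,\nabla\phi(\mathbf{x}_0))\le0$ whenever $w-\phi$ has a local minimum at $\mathbf{x}_0$ (supersolution). (This is the usual notion for the equation $-H=0$, the convention under which the value function of the associated minimal-cost control problem is the viscosity solution.) The article ''the'' follows the paper, which takes uniqueness of viscosity solutions under these assumptions as known. *)

(* Defs.v *)
From HB Require Import structures.
From mathcomp Require Import all_boot all_order all_algebra.
From mathcomp Require Import all_classical all_reals all_analysis.
Set Implicit Arguments.
Unset Strict Implicit.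
Unset Printing Implicit Defensive.
Import Order.TTheory GRing.Theory Num.Theory.
Import numFieldNormedType.Exports.
Local Open Scope classical_set_scope.
Local Open Scope ring_scope.

(* Points of R^n are row vectors. The library norm `|_| on 'rV[R]_n is the sup
   norm; it is used only for topology, differentiability and Lipschitz
   continuity, which do not depend on the choice of a norm. Lengths and
   distances are measured with enorm.

   A function on a subset M of R^n (a surface, a tube, ...) is a total function
   of which only the values on M are ever used. *)

Definition dot (R : realType) n (u v : 'rV[R]_n) : R := (u *m v^T) 0 0.

Definition enorm (R : realType) n (u : 'rV[R]_n) : R := Num.sqrt (dot u u).

Definition tensor (R : realType) n (u v : 'rV[R]_n) : 'M[R]_n := u^T *m v.

Definition boundary (T : topologicalType) (A : set T) : set T :=
  closure A `\` interior A.

Definition grad (R : realType) n (phi : 'rV[R]_n -> R) (z : 'rV[R]_n) :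
    'rV[R]_n :=
  \row_i 'D_(delta_mx 0 i) phi z.

(* phi is of class C^k on the open set U *)
Fixpoint Ck (R : realType) n (k : nat) (U : set 'rV[R]_n)
    (phi : 'rV[R]_n -> R) : Prop :=
  match k with
  | 0 => forall x, U x -> {for x, continuous phi}
  | k'.+1 => (forall x, U x -> differentiable phi x) /\
             (forall v, Ck k' U ('D_v phi))
  end.

(* Omega has a smooth boundary: near each boundary point, Omega is the
   sublevel set {rho < 0} of a C^oo function rho without critical point *)
Definition smooth_boundary (R : realType) n (Omega : set 'rV[R]_n) : Prop :=
  forall x, boundary Omega x ->
  exists (U : set 'rV[R]_n) (rho : 'rV[R]_n -> R),
    [/\ open U, U x, (forall k, Ck k U rho),
        (forall y, U y -> grad rho y != 0) &
        (forall y, U y -> (Omega y <-> rho y < 0) /\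
                          (boundary Omega y <-> rho y = 0))].

Definition dist (R : realType) n (A : set 'rV[R]_n) (z : 'rV[R]_n) : R :=
  inf [set enorm (x - z) | x in A].

Definition tube (R : realType) n (A : set 'rV[R]_n) (e : R) : set 'rV[R]_n :=
  [set z | dist A z < e].

Definition is_closest (R : realType) n (A : set 'rV[R]_n) (z y : 'rV[R]_n) :
    Prop :=
  A y /\ forall x, A x -> enorm (z - y) <= enorm (z - x).

Definition closest_point (R : realType) n (A : set 'rV[R]_n) (z : 'rV[R]_n) :
    'rV[R]_n :=
  xget z [set y | is_closest A z y].

Definition reach (R : realType) n (A : set 'rV[R]_n) : \bar R :=
  ereal_sup [set rho%:E | rho in
    [set rho | forall z, dist A z < rho -> exists! y, is_closest A z y]].

Definition signed_dist (R : realType) n (Omega : set 'rV[R]_n)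
    (z : 'rV[R]_n) : R :=
  if z \in Omega then - dist (boundary Omega) z else dist (boundary Omega) z.

Definition parallel_surface (R : realType) n (Omega : set 'rV[R]_n)
    (e eta : R) : set 'rV[R]_n :=
  [set z | tube (boundary Omega) e z /\ signed_dist Omega z = eta].

(* gamma is a curve in M through x with velocity v at x *)
Definition curve_at (R : realType) n (M : set 'rV[R]_n) (x v : 'rV[R]_n)
    (gamma : R -> 'rV[R]_n) : Prop :=
  [/\ gamma 0 = x, (\forall s \near 0, M (gamma s)) &
      is_derive (0 : R) (1 : R) gamma v].

Definition tangent (R : realType) n (M : set 'rV[R]_n) (x v : 'rV[R]_n) :
    Prop :=
  exists gamma, curve_at M x v gamma.

Definition unit_normal (R : realType) n (M : set 'rV[R]_n)
    (x nu : 'rV[R]_n) : Prop :=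
  enorm nu = 1 /\ forall v, tangent M x v -> dot nu v = 0.

Definition C1_surface (R : realType) n (M : set 'rV[R]_n)
    (phi : 'rV[R]_n -> R) : Prop :=
  forall x, M x -> exists (U : set 'rV[R]_n) (Phi : 'rV[R]_n -> R),
    [/\ open U, U x, Ck 1 U Phi & forall y, M y -> U y -> phi y = Phi y].

(* The tangent vector representing the differential of phi along M *)
Definition is_surface_grad (R : realType) n (M : set 'rV[R]_n)
    (phi : 'rV[R]_n -> R) (x p : 'rV[R]_n) : Prop :=
  tangent M x p /\
  forall v gamma, curve_at M x v gamma ->
    is_derive (0 : R) (1 : R) (phi \o gamma) (dot p v).

Definition surface_grad (R : realType) n (M : set 'rV[R]_n)
    (phi : 'rV[R]_n -> R) (x : 'rV[R]_n) : 'rV[R]_n :=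
  xget 0 [set p | is_surface_grad M phi x p].

(* The orthonormal frame t_i, nu at z of the parallel surface through z, with
   its principal curvatures kappa_i and the singular values sigma_i of the
   Jacobian of the closest point map. Curvatures are taken with respect to the
   outward unit normal field grad (signed_dist Omega) of the parallel surfaces,
   whose derivative along t_i is kappa_i t_i; thus spheres bounding a ball have
   positive curvature, in accordance with sigma_i = 1 - d kappa_i. The unit
   normal nu is only determined up to sign, which the tensor B ignores. *)
Definition principal_frame (R : realType) n (Omega : set 'rV[R]_n) (e : R)
    (z : 'rV[R]_n) (t : 'I_n.-1 -> 'rV[R]_n) (nu : 'rV[R]_n)
    (kappa sigma : 'I_n.-1 -> R) : Prop :=
  let d := signed_dist Omega in
  let S := parallel_surface Omega e (d z) in
  [/\ (forall i j, dot (t i) (t j) = (i == j)%:R)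
      /\ (forall i, tangent S z (t i)),
      unit_normal S z nu,
      (forall i, is_derive z (t i) (grad d) (kappa i *: t i)),
      (forall i, sigma i = 1 - d z * kappa i /\ 0 < sigma i) &
      'J (closest_point (boundary Omega)) z =
        \sum_i sigma i *: tensor (t i) (t i)].

Definition tensorB (R : realType) n (t : 'I_n.-1 -> 'rV[R]_n)
    (nu : 'rV[R]_n) (sigma : 'I_n.-1 -> R) (mu : R) : 'M[R]_n :=
  \sum_i (sigma i)^-1 *: tensor (t i) (t i) + mu *: tensor nu nu.

Definition lower_semicontinuous_on (R : realType) n (K : set 'rV[R]_n)
    (g : 'rV[R]_n -> R) : Prop :=
  forall x, K x -> forall a, a < g x ->
    \forall y \near within K (nbhs x), a < g y.

(* w is a viscosity solution of H(x, Dw(x)) = 0 on M `\` K with w = h on K,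
   where C1 is the class of test functions and D their gradient. The signs are
   those of the usual notion for the equation -H = 0. *)
Definition viscosity_solution (R : realType) n (M K : set 'rV[R]_n)
    (C1 : set ('rV[R]_n -> R))
    (D : ('rV[R]_n -> R) -> 'rV[R]_n -> 'rV[R]_n)
    (H : 'rV[R]_n -> 'rV[R]_n -> R) (h w : 'rV[R]_n -> R) : Prop :=
  [/\ {within M, continuous w},
      (forall x, K x -> w x = h x),
      (forall phi x0, C1 phi -> (M `\` K) x0 ->
        (\forall x \near within M (nbhs x0), w x - phi x <= w x0 - phi x0) ->
        0 <= H x0 (D phi x0)) &
      (forall phi x0, C1 phi -> (M `\` K) x0 ->
        (\forall x \near within M (nbhs x0), w x0 - phi x0 <= w x - phi x) ->
        H x0 (D phi x0) <= 0)].

Definition surface_viscosity_solution (R : realType) n (M K : set 'rV[R]_n) :=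
  viscosity_solution M K (C1_surface M) (surface_grad M).

(* M is an open subset of R^n *)
Definition euclidean_viscosity_solution (R : realType) n
    (M K : set 'rV[R]_n) :=
  viscosity_solution M K (Ck 1 M) (@grad R n).

(* Main.v *)
Require Import Defs.
From HB Require Import structures.
From mathcomp Require Import all_boot all_order all_algebra.
From mathcomp Require Import all_classical all_reals all_analysis.
From mathcomp Require Import ring lra.
Set Implicit Arguments.
Unset Strict Implicit.
Unset Printing Implicit Defensive.
Import Order.TTheory GRing.Theory Num.Theory.
Import numFieldNormedType.Exports.
Local Open Scope classical_set_scope.
Local Open Scope ring_scope.

(* Closest points satisfy z = P z + c N(P z) with N the outward unit normal and
   |c| = dist z.  Conversely P (x + s N x) = x for all |s| < e: the set of such
   s >= 0 is closed in [0, e) by continuity of P, and it is open because 'd P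
   annihilates the normal direction, so that the displacement of the foot point
   along the normal line through x is bounded by a small multiple of itself.

   Let phi be a test function touching u o P at z, let c be the height of z
   above Gamma and x = P z.  Then psi := phi (. + c N(.)) is a C^1 function on
   Gamma touching u at x in the same way.  As u o P is constant along the normal
   line, the normal derivative of phi at z vanishes; as psi o P = phi on the
   parallel surface through z, the surface gradient p of psi at x satisfies
   sigma_i p.t_i = grad phi(z).t_i.  Hence p = B grad phi(z), and the two
   viscosity inequalities are literally the same. *)

(** * Euclidean structure *)

Section dot.
Variables (R : realType) (n : nat).
Implicit Types (u v w : 'rV[R]_n) (a : R).

Lemma dotE u v : dot u v = \sum_i u 0 i * v 0 i.
Proof. by rewrite /dot mxE; apply: eq_bigr => i _; rewrite mxE. Qed.

Lemma dotC u v : dot u v = dot v u.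
Proof. by rewrite !dotE; apply: eq_bigr => i _; rewrite mulrC. Qed.

Lemma dotDl u v w : dot (u + v) w = dot u w + dot v w.
Proof. by rewrite /dot mulmxDl mxE. Qed.

Lemma dotZl a u v : dot (a *: u) v = a * dot u v.
Proof. by rewrite /dot -scalemxAl mxE. Qed.

Lemma dotNl u v : dot (- u) v = - dot u v.
Proof. by rewrite -scaleN1r dotZl mulN1r. Qed.

Lemma dotBl u v w : dot (u - v) w = dot u w - dot v w.
Proof. by rewrite dotDl dotNl. Qed.

Lemma dotDr u v w : dot w (u + v) = dot w u + dot w v.
Proof. by rewrite dotC dotDl !(dotC w). Qed.

Lemma dotZr a u v : dot u (a *: v) = a * dot u v.
Proof. by rewrite dotC dotZl dotC. Qed.

Lemma dotNr u v : dot u (- v) = - dot u v.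
Proof. by rewrite dotC dotNl dotC. Qed.

Lemma dotBr u v w : dot w (u - v) = dot w u - dot w v.
Proof. by rewrite dotDr dotNr. Qed.

Lemma dot0l u : dot 0 u = 0.
Proof. by rewrite /dot mul0mx mxE. Qed.

Lemma dot_suml (I : Type) (s : seq I) (Q : pred I) (F : I -> 'rV[R]_n) v :
  dot (\sum_(i <- s | Q i) F i) v = \sum_(i <- s | Q i) dot (F i) v.
Proof.
by elim/big_ind2 : _ => [|x x' y y' <- <-|//]; rewrite ?dot0l ?dotDl.
Qed.

Lemma dot_ge0 u : 0 <= dot u u.
Proof. by rewrite dotE sumr_ge0 // => i _; rewrite -expr2 sqr_ge0. Qed.

Lemma dot_eq0 u : (dot u u == 0) = (u == 0).
Proof.
apply/eqP/eqP => [|->]; last by rewrite dot0l.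
rewrite dotE => /eqP; rewrite psumr_eq0; last first.
  by move=> i _; rewrite -expr2 sqr_ge0.
move=> /allP u0; apply/rowP => i; rewrite mxE; apply/eqP.
by have := u0 i (mem_index_enum _); rewrite /= -expr2 sqrf_eq0.
Qed.

Lemma dot_gt0 u : u != 0 -> 0 < dot u u.
Proof. by move=> u0; rewrite lt_neqAle dot_ge0 andbT eq_sym dot_eq0. Qed.

Lemma enorm_ge0 u : 0 <= enorm u.
Proof. exact: sqrtr_ge0. Qed.

Lemma sqr_enorm u : enorm u ^+ 2 = dot u u.
Proof. by rewrite sqr_sqrtr // dot_ge0. Qed.

(** Cauchy-Schwarz: expand the square of [dot v v *: u - dot u v *: v] and cancel the positive
    factor [dot v v]. *)
Lemma dot_le_enorm u v : dot u v <= enorm u * enorm v.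
Proof.
have [->|v0] := eqVneq v 0.
  by rewrite dotC dot0l mulr_ge0 ?enorm_ge0.
have v_gt0 := dot_gt0 v0.
apply: le_trans (ler_norm _) _; rewrite -sqrtr_sqr -sqrtrM ?dot_ge0 // ler_wsqrtr //.
have := dot_ge0 (dot v v *: u - dot u v *: v).
rewrite dotBl !dotBr !dotZl !dotZr (dotC v u) => h.
have {}h : 0 <= dot v v * (dot u u * dot v v - dot u v ^+ 2) by lra.
by move: h; rewrite pmulr_rge0 // subr_ge0.
Qed.

Lemma ler_enormD u v : enorm (u + v) <= enorm u + enorm v.
Proof.
rewrite -(@ler_pXn2r _ 2) ?nnegrE ?addr_ge0 ?enorm_ge0 // sqrrD !sqr_enorm.
rewrite dotDl !dotDr (dotC v u); have := dot_le_enorm u v; lra.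
Qed.

Lemma enormZ a u : enorm (a *: u) = `|a| * enorm u.
Proof.
rewrite /enorm dotZl dotZr mulrA -expr2 sqrtrM ?sqr_ge0 //.
by rewrite sqrtr_sqr.
Qed.

Lemma enormN u : enorm (- u) = enorm u.
Proof. by rewrite -scaleN1r enormZ normrN1 mul1r. Qed.

Lemma enorm_distC u v : enorm (u - v) = enorm (v - u).
Proof. by rewrite -enormN opprB. Qed.

Lemma enorm0 : enorm (0 : 'rV[R]_n) = 0.
Proof. by rewrite /enorm dot0l sqrtr0. Qed.

Lemma enorm_eq0 u : (enorm u == 0) = (u == 0).
Proof. by rewrite -dot_eq0 -sqr_enorm sqrf_eq0. Qed.

Lemma normr_coord_le u i : `|u 0 i| <= `|u|.
Proof.
rewrite [leRHS]/Num.Def.normr /= mx_normrE.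
exact: (le_bigmax _ (fun ij => `|u ij.1 ij.2|) (0, i)).
Qed.

Lemma dot_le_norm u v : `|dot u v| <= n%:R * `|u| * `|v|.
Proof.
rewrite dotE (le_trans (ler_norm_sum _ _ _)) //.
rewrite -[n in n%:R]card_ord -mulrA mulr_natl -sumr_const ler_sum // => i _.
by rewrite normrM ler_pM ?normr_coord_le.
Qed.

Lemma norm_le_enorm u : `|u| <= enorm u.
Proof.
rewrite [leLHS]/Num.Def.normr /= mx_normrE bigmax_le ?enorm_ge0 // => -[i j] _.
rewrite /= ord1 -sqrtr_sqr ler_wsqrtr // dotE (bigD1 j) //= -expr2 lerDl.
by rewrite sumr_ge0 // => k _; rewrite -expr2 sqr_ge0.
Qed.

(** [dot_le_norm] bounds [dot u u] by [n] times the squared sup norm; one factor is at most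
    [enorm u], which then cancels. *)
Lemma enorm_le_norm u : enorm u <= n%:R * `|u|.
Proof.
have [->|u0] := eqVneq u 0; first by rewrite enorm0 normr0 mulr0.
have := le_trans (ler_norm _) (dot_le_norm u u); rewrite -sqr_enorm => h.
have e_gt0 : 0 < enorm u by rewrite lt_neqAle eq_sym enorm_eq0 u0 enorm_ge0.
rewrite -(ler_pM2r e_gt0) -expr2 (le_trans h) //.
by rewrite ler_wpM2l ?mulr_ge0 ?ler0n // norm_le_enorm.
Qed.

Lemma tensor_mul (p u v : 'rV[R]_n) : p *m tensor u v = dot p u *: v.
Proof. by rewrite /tensor mulmxA [p *m _]mx11_scalar mul_scalar_mx. Qed.

Lemma tr_tensor u v : (tensor u v)^T = tensor v u.
Proof. by rewrite /tensor trmx_mul trmxK. Qed.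

End dot.

(** The rows [N] and [t i] form a square matrix [Q] with [Q *m Q^T = 1]. A one-sided inverse of a
    square matrix is two-sided, so [v = v *m (Q^T *m Q)], which is the expansion sought. *)
Lemma orthonormal_decomp (R : realType) n (t : 'I_n.-1 -> 'rV[R]_n)
    (N : 'rV[R]_n) (n_gt0 : (0 < n)%N) :
  (forall i j, dot (t i) (t j) = (i == j)%:R) ->
  dot N N = 1 -> (forall i, dot N (t i) = 0) ->
  forall v, v = \sum_i dot v (t i) *: t i + dot v N *: N.
Proof.
case: n => // m in t N n_gt0 *.
rewrite /= in t * => tt NN Nt v.
pose r i : 'rV_m.+1 := if unlift ord0 i is Some j then t j else N.
pose Q := \matrix_i r i.
have QQ : Q *m Q^T = 1%:M.
  apply/matrixP => i j; transitivity (dot (r i) (r j)).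
    by rewrite !mxE dotE; apply: eq_bigr => k _; rewrite !mxE.
  rewrite mxE /r; case: unliftP => [i'|] ->; case: unliftP => [j'|] ->.
  - by rewrite tt (inj_eq (@lift_inj _ _)).
  - by rewrite dotC Nt lift_eqF.
  - by rewrite Nt eq_liftF.
  - by rewrite eqxx.
have : v *m (Q^T *m Q) = v by rewrite (mulmx1C QQ) mulmx1.
rewrite mulmxA mulmx_sum_row big_ord_recl /= => vE; rewrite -{1}vE addrC.
have coordE i : (v *m Q^T) 0 i = dot v (r i).
  by rewrite mxE dotE; apply: eq_bigr => k _; rewrite !mxE.
congr (_ + _); last by rewrite coordE rowK /r unlift_none.
by apply: eq_bigr => i _; rewrite coordE rowK /r liftK.
Qed.

(** * First-order calculus *)

Section differentials.
Variables (R : realType) (V W : normedModType R).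

(** The little-o remainder with an explicit radius, so that several estimates can be combined
    numerically. *)
Lemma differentiable_expansion (f : V -> W) z (eps : R) :
  differentiable f z -> 0 < eps -> exists2 d : R, 0 < d &
  forall k, `|k| < d -> `|f (z + k) - f z - 'd f z k| <= eps * `|k|.
Proof.
move=> /diff_locally /eqaddoP /(_ eps) h eps_gt0.
have /nbhs_ballP[d /= d_gt0 hd] := h eps_gt0.
exists d => // k kd; have /hd : ball 0 d k.
  by rewrite -ball_normE /= sub0r normrN.
by rewrite /= /cst /= !fctE /= opprD addrA (addrC k).
Qed.

Lemma differentiable_lipschitz_at (f : V -> W) z : differentiable f z ->
  exists L d : R, [/\ 0 < L, 0 < d &
    forall k, `|k| < d -> `|f (z + k) - f z| <= L * `|k|].
Proof.
move=> fz; have [d d_gt0 hd] := differentiable_expansion fz ltr01.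
have [L L_gt0 hL] := linear_lipschitz (diff_continuous fz).
exists (1 + L), d; split=> [|//|k /hd]; first by rewrite addr_gt0.
move=> hk; rewrite -(subrK ('d f z k) (f (z + k) - f z)) mulrDl.
by rewrite (le_trans (ler_normD _ _)) // lerD.
Qed.

Lemma is_derive_comp_diff (gamma : R -> V) (f : V -> W) v :
  is_derive (0 : R) (1 : R) gamma v -> differentiable f (gamma 0) ->
  is_derive (0 : R) (1 : R) (f \o gamma) ('d f (gamma 0) v).
Proof.
move=> [/derivable1_diffP dg <-] df.
have dfg : differentiable (f \o gamma) 0 by exact: differentiable_comp.
split; first exact/derivable1_diffP.
by rewrite !deriveE // diff_comp.
Qed.

Lemma is_derive_line (z w : V) :
  is_derive (0 : R) (1 : R) (fun s : R => z + s *: w) w.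
Proof.
have -> : (fun s : R => z + s *: w) = cst z + ( *:%R ^~ w) by [].
have d1 : is_diff (0 : R) (cst z + ( *:%R ^~ w)) (0 + ( *:%R ^~ w)).
  exact: is_diffD.
split; first exact/derivable1_diffP/ex_diff.
by rewrite deriveE // diff_val /= !fctE scale1r add0r.
Qed.

Lemma is_derive_comp_line (f : V -> W) z w : differentiable f z ->
  is_derive (0 : R) (1 : R) (fun s : R => f (z + s *: w)) ('d f z w).
Proof.
move=> df; have := @is_derive_comp_diff _ f _ (is_derive_line z w).
by rewrite scale0r addr0; apply.
Qed.

End differentials.

Lemma is_derive_unique (R : realType) (V : normedModType R) (f : R -> V) a b :
  is_derive (0 : R) (1 : R) f a -> is_derive (0 : R) (1 : R) f b -> a = b.
Proof. by move=> [_ <-] [_ <-]. Qed.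

Lemma local_min_derive0 (R : realType) (f : R -> R) a :
  (\forall s \near 0, f 0 <= f s) ->
  is_derive (0 : R) (1 : R) f a -> a = 0.
Proof.
move=> /nbhs_ballP[d1 /= d1_gt0 hd1] [df fa]; apply/eqP/negPn/negP => a0.
have eps_gt0 : 0 < `|a| / 2 by rewrite divr_gt0 ?normr_gt0.
have df' := df; move/derivable1_diffP : df' => df'.
have [d2 d2_gt0 hd2] := differentiable_expansion df' eps_gt0.
pose h := Num.min d1 d2 / 2.
have m_gt0 : 0 < Num.min d1 d2 by rewrite lt_min d1_gt0.
have h_gt0 : 0 < h by rewrite divr_gt0.
have hm : h < Num.min d1 d2 by rewrite /h; lra.
have [h1 h2] : h < d1 /\ h < d2 by move: hm; rewrite lt_min => /andP.
(* A step of length [h] against the sign of [a]: the linear term is the product of -|a| and [h], and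
   the remainder is at most half of that in size, so [f] would drop below [f 0]. *)
pose k := - (a / `|a|) * h.
have na0 : `|a| != 0 by rewrite normr_eq0.
have nk : `|k| = h.
  by rewrite /k normrM normrN normrM normfV normr_id divff // mul1r gtr0_norm.
have ka : k * a = - (`|a| * h).
  have aa : a * a = `|a| * `|a| by rewrite -!expr2 real_normK ?num_real.
  have -> : k * a = - (a * a / `|a|) * h by rewrite /k; ring.
  by rewrite aa mulfK // mulNr.
have := hd1 k; rewrite -ball_normE /= sub0r normrN nk => /(_ h1) fk.
have := hd2 k; rewrite nk add0r deriv1E // derive1E fa => /(_ h2).
rewrite -[k *: a]/(k * a) ka => /(le_trans (ler_norm _)) hle.
have : 0 < `|a| * h by rewrite mulr_gt0 // normr_gt0.
lra.
Qed.

Section velocity.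
Variables (R : realType) (n : nat).
Implicit Types (gamma : R -> 'rV[R]_n).

Lemma derive_coord (x v : 'rV[R]_n) i : 'D_v (fun y : 'rV[R]_n => y 0 i) x = v 0 i.
Proof.
have /matrixP/(_ 0 i) := derive_mx (@derivable_id _ _ x v).
by rewrite derive_id mxE.
Qed.

Lemma is_derive_coord gamma v i : is_derive (0 : R) (1 : R) gamma v ->
  is_derive (0 : R) (1 : R) (fun s => gamma s 0 i) (v 0 i).
Proof.
move=> dg; have dc := differentiable_coord (gamma 0) 0 i.
by have := is_derive_comp_diff dg dc; rewrite -deriveE // derive_coord.
Qed.

Lemma is_derive_dot gamma1 gamma2 v1 v2 :
  is_derive (0 : R) (1 : R) gamma1 v1 -> is_derive (0 : R) (1 : R) gamma2 v2 ->
  is_derive (0 : R) (1 : R) (fun s => dot (gamma1 s) (gamma2 s))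
    (dot v1 (gamma2 0) + dot (gamma1 0) v2).
Proof.
move=> d1 d2.
have -> : (fun s => dot (gamma1 s) (gamma2 s)) =
    \sum_i ((fun s => gamma1 s 0 i) * (fun s => gamma2 s 0 i)).
  by apply/funext => s; rewrite fct_sumE dotE.
rewrite !dotE -big_split /=.
apply: is_derive_sum => i; have c1 := is_derive_coord i d1.
have c2 := is_derive_coord i d2; have := is_deriveM c1 c2.
by move=> /is_derive_eq; apply; rewrite addrC; congr (_ + _); exact: mulrC.
Qed.

End velocity.

Section gradient.
Variables (R : realType) (n : nat).

Lemma diff_grad (phi : 'rV[R]_n -> R) z v :
  differentiable phi z -> 'd phi z v = dot (grad phi z) v.
Proof.
move=> dphi; rewrite [in LHS](row_sum_delta v) linear_sum dotE.
apply: eq_bigr => i _; rewrite linearZ /= mxE deriveE //.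
by rewrite mulrC.
Qed.

End gradient.

(** * Functions of class C^1 *)

Section C1_calculus.
Variables (R : realType) (n : nat) (U : set 'rV[R]_n).
Hypothesis U_open : open U.
Implicit Types f g : 'rV[R]_n -> R.

Lemma Ck1_continuous f x : Ck 1 U f -> U x -> {for x, continuous f}.
Proof. by move=> [df _] Ux; apply/differentiable_continuous/df. Qed.

(** The formula for the derivative is known on [U] only. Since [U] is open, it holds near each of
    its points, which suffices to transfer continuity. *)
Lemma Ck1_of_derive f (df : 'rV[R]_n -> 'rV[R]_n -> R) :
  (forall x, U x -> differentiable f x) ->
  (forall v x, U x -> 'D_v f x = df v x) ->
  (forall v x, U x -> {for x, continuous (df v)}) -> Ck 1 U f.
Proof.
move=> f_diff fE df_cont; split=> // v x Ux.
rewrite /prop_for /continuous_at fE //.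
apply: cvg_trans (df_cont v x Ux); apply: (@near_eq_cvg _ _ (nbhs x)).
near=> y; apply/esym/fE; near: y; exact: open_nbhs_nbhs.
Unshelve. all: by end_near.
Qed.

Lemma Ck1_cst a : Ck 1 U (cst a).
Proof.
apply: (Ck1_of_derive (df := fun _ _ => 0)) => [x _|v x _|v x _].
- exact: differentiable_cst.
- exact: derive_cst.
- exact: cst_continuous.
Qed.

Lemma Ck1_coord i : Ck 1 U (fun x => x 0 i).
Proof.
apply: (Ck1_of_derive (df := fun v _ => v 0 i)) => [x _|v x _|v x _].
- exact: differentiable_coord.
- exact: derive_coord.
- exact: cst_continuous.
Qed.

Lemma Ck1_add f g : Ck 1 U f -> Ck 1 U g -> Ck 1 U (fun x => f x + g x).
Proof.
move=> [df cf] [dg cg]; rewrite -[fun _ => _]/(f + g).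
apply: (Ck1_of_derive (df := fun v x => 'D_v f x + 'D_v g x)).
- by move=> x Ux; apply: differentiableD; [exact: df|exact: dg].
- by move=> v x Ux; rewrite deriveD //; apply: diff_derivable;
    [exact: df|exact: dg].
- by move=> v x Ux; exact: (continuousD (cf v x Ux) (cg v x Ux)).
Qed.

Lemma Ck1_mul f g : Ck 1 U f -> Ck 1 U g -> Ck 1 U (fun x => f x * g x).
Proof.
move=> f1 g1; have [[df cf] [dg cg]] := (f1, g1).
rewrite -[fun _ => _]/(f * g).
apply: (Ck1_of_derive (df := fun v x => f x * 'D_v g x + g x * 'D_v f x)).
- by move=> x Ux; apply: differentiableM; [exact: df|exact: dg].
- by move=> v x Ux; rewrite deriveM //; apply: diff_derivable;
    [exact: df|exact: dg].
- move=> v x Ux.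
  exact: (continuousD (continuousM (Ck1_continuous f1 Ux) (cg v x Ux))
                      (continuousM (Ck1_continuous g1 Ux) (cf v x Ux))).
Qed.

Lemma Ck1_sum (I : Type) (s : seq I) (F : I -> 'rV[R]_n -> R) :
  (forall i, Ck 1 U (F i)) -> Ck 1 U (fun x => \sum_(i <- s) F i x).
Proof.
move=> F1; elim: s => [|i s ih].
  by under eq_fun do rewrite big_nil; exact: Ck1_cst.
by under eq_fun do rewrite big_cons; exact: Ck1_add.
Qed.

Lemma Ck1_inv f : Ck 1 U f -> (forall x, U x -> f x != 0) ->
  Ck 1 U (fun x => (f x)^-1).
Proof.
move=> f1 f0; have [df cf] := f1.
apply: (Ck1_of_derive (df := fun v x => - (f x * f x)^-1 * 'D_v f x)).
- by move=> x Ux; apply: differentiableV; [exact: df|exact: f0].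
- by move=> v x Ux; rewrite -expr2 deriveV //; [exact: f0|exact/diff_derivable/df].
- move=> v x Ux; have fc := Ck1_continuous f1 Ux.
  have f2x0 : f x * f x != 0 by rewrite mulf_neq0 ?f0.
  have ic := continuousV (s := f \* f) f2x0 (continuousM fc fc).
  exact: (continuousM (continuousN ic) (cf v x Ux)).
Qed.

Lemma Ck1_sqrt f : Ck 1 U f -> (forall x, U x -> 0 < f x) ->
  Ck 1 U (fun x => Num.sqrt (f x)).
Proof.
move=> f1 f0; have [df cf] := f1.
have dsqrt x : U x -> differentiable (@Num.sqrt R) (f x).
  by move=> /f0 fx0; apply/derivable1_diffP; have [] := is_derive1_sqrt fx0.
apply: (Ck1_of_derive (df := fun v x => (2 * Num.sqrt (f x))^-1 * 'D_v f x)).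
- by move=> x Ux; apply: differentiable_comp; [exact: df|exact: dsqrt].
- move=> v x Ux; have dfx := df x Ux.
  rewrite [LHS](deriveE _ (differentiable_comp dfx (dsqrt x Ux))).
  rewrite diff_comp //; last exact: dsqrt.
  have [sd sE] := is_derive1_sqrt (f0 x Ux).
  by rewrite /= -(deriveE v dfx) deriv1E // derive1E sE [RHS]mulrC.
- move=> v x Ux; have fc := Ck1_continuous f1 Ux.
  have s0 : 2 * Num.sqrt (f x) != 0 by rewrite mulf_neq0 // gt_eqF // sqrtr_gt0 f0.
  have sc : {for x, continuous (fun y => Num.sqrt (f y))}.
    exact: (continuous_comp fc (@sqrt_continuous R (f x))).
  have ic := continuousV (s := cst 2 \* (fun y => Num.sqrt (f y))) s0
    (continuousM (@cst_continuous _ R (2 : R) x) sc).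
  exact: (continuousM ic (cf v x Ux)).
Qed.

Lemma continuous_at_sum (I : Type) (s : seq I) (F : I -> 'rV[R]_n -> R) x :
  (forall i, {for x, continuous (F i)}) ->
  {for x, continuous (fun y => \sum_(i <- s) F i y)}.
Proof.
move=> Fc; elim: s => [|i s ih].
  suff -> : (fun y => \sum_(i <- [::]) F i y) = cst 0 by exact: cst_continuous.
  by apply/funext => y; rewrite big_nil.
suff -> : (fun y => \sum_(j <- i :: s) F j y) =
  F i + (fun y => \sum_(i <- s) F i y) by exact: continuousD.
by apply/funext => y; rewrite big_cons.
Qed.

Lemma rV_differentiable (F : 'rV[R]_n -> 'rV[R]_n) x :
  (forall i, differentiable (fun y => F y 0 i) x) -> differentiable F x.
Proof.
move=> Fi; have -> : F = \sum_i (fun y => F y 0 i *: delta_mx 0 i).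
  by apply/funext => y; rewrite fct_sumE; exact: row_sum_delta.
by apply: differentiable_sum => i; exact: differentiableZl.
Qed.

(** By the chain rule, the derivative along [v] is the sum of the partial derivatives of [phi] at
    [F x] times the derivatives of the coordinates of [F], hence continuous. *)
Lemma Ck1_comp (V : set 'rV[R]_n) (phi : 'rV[R]_n -> R)
    (F : 'rV[R]_n -> 'rV[R]_n) :
  Ck 1 V phi -> (forall i, Ck 1 U (fun x => F x 0 i)) -> U `<=` F @^-1` V ->
  Ck 1 U (phi \o F).
Proof.
move=> [dphi cphi] F1 UV.
have dF x : U x -> differentiable F x.
  by move=> Ux; apply: rV_differentiable => i; have [dFi _] := F1 i; exact: dFi.
have dphiF x : U x -> differentiable phi (F x) by move=> /UV/dphi.
apply: (Ck1_of_derive (df := fun v x => \sum_i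
   'D_(delta_mx 0 i) phi (F x) * 'D_v (fun y => F y 0 i) x)).
- by move=> x Ux; apply: differentiable_comp; [exact: dF|exact: dphiF].
- move=> v x Ux; have [dFx dphix] := (dF x Ux, dphiF x Ux).
  rewrite deriveE; last exact: differentiable_comp.
  rewrite diff_comp //= diff_grad // dotE; apply: eq_bigr => i _; rewrite mxE.
  by rewrite -deriveE // derive_mx ?mxE //; exact: diff_derivable.
- move=> v x Ux; apply: continuous_at_sum => i; have [_ dFi] := F1 i.
  have Fc := differentiable_continuous (dF x Ux).
  have phic := cphi (delta_mx 0 i) (F x) (UV x Ux).
  exact: (continuousM (continuous_comp Fc phic) (dFi v x Ux)).
Qed.

End C1_calculus.

(** * Vector fields of class C^1 along a set *)

Lemma near_norm_lt (R : realType) n (x : 'rV[R]_n) (d : R) :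
  0 < d -> \forall y \near x, `|y - x| < d.
Proof.
move=> d0; apply/nbhs_ballP; exists d => // y.
by rewrite -ball_normE /= distrC.
Qed.

(** As for [C1_surface], regularity along [A] means a local C^1 extension to an open set, because
    [N] carries information on [A] only. *)
Definition C1_field_on (R : realType) n (A : set 'rV[R]_n)
    (N : 'rV[R]_n -> 'rV[R]_n) : Prop :=
  forall x, A x -> exists (U : set 'rV[R]_n) (F : 'rV[R]_n -> 'rV[R]_n),
    [/\ open U, U x, (forall i, Ck 1 U (fun y => F y 0 i)) &
        forall y, A y -> U y -> N y = F y].

Lemma C1_field_lipschitz (R : realType) n (A : set 'rV[R]_n) N x :
  C1_field_on A N -> A x -> exists L d : R, [/\ 0 < L, 0 < d &
    forall y, A y -> `|y - x| < d -> `|N y - N x| <= L * `|y - x|].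
Proof.
move=> N1 Ax; have [U [F [Uo Ux F1 NF]]] := N1 x Ax.
have Fx : differentiable F x.
  by apply: rV_differentiable => i; have [dFi _] := F1 i; exact: dFi.
have [L [d [L0 d0 FL]]] := differentiable_lipschitz_at Fx.
have /nbhs_ballP[d' /= d'0 Ud'] := open_nbhs_nbhs (conj Uo Ux).
exists L, (Num.min d d'); split=> //; first by rewrite lt_min d0.
move=> y Ay; rewrite lt_min => /andP[yd yd'].
rewrite !NF //; last by apply: Ud'; rewrite -ball_normE /= distrC.
by have := FL _ yd; rewrite [x + _]addrC subrK.
Qed.

(** * Closest points *)

Section closest_points.
Variables (R : realType) (n : nat) (A : set 'rV[R]_n).
Implicit Types (x y z : 'rV[R]_n).

Lemma dist_le z x : A x -> dist A z <= enorm (z - x).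
Proof.
move=> Ax; apply: ge_inf; last by exists x => //; rewrite enorm_distC.
by exists 0 => _ [y _ <-]; exact: enorm_ge0.
Qed.

Lemma dist_ge0 z : 0 <= dist A z.
Proof.
have [[x Ax]|A0] := pselect (A !=set0).
  apply: lb_le_inf; first by exists (enorm (x - z)), x.
  by move=> _ [y _ <-]; exact: enorm_ge0.
(* For empty [A] the infimum is that of the empty set, which is 0 by convention. *)
rewrite /dist (_ : A = set0) ?image_set0 ?inf0 //.
by apply/seteqP; split=> // x Ax; apply: A0; exists x.
Qed.

Lemma dist_closest z y : is_closest A z y -> dist A z = enorm (z - y).
Proof.
move=> [Ay zy]; apply/eqP; rewrite eq_le dist_le //= lb_le_inf //.
  by exists (enorm (y - z)), y.
by move=> _ [x Ax <-]; rewrite (enorm_distC x) zy.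
Qed.

Lemma closest_self x : A x -> is_closest A x x.
Proof. by move=> Ax; split=> // y _; rewrite subrr enorm0 enorm_ge0. Qed.

(** If [w] is the point of the segment, the triangle inequality gives |z - x| <= (1 - l) |z - y| +
    |w - x|. With |z - y| <= |z - x| this leaves l |z - y| <= |w - x|. *)
Lemma closest_segment z y (l : R) : is_closest A z y -> 0 <= l <= 1 ->
  is_closest A (y + l *: (z - y)) y.
Proof.
move=> [Ay zy] /andP[l0 l1]; split=> // x Ax.
have -> : y + l *: (z - y) - y = l *: (z - y) by rewrite addrC addKr.
have := ler_enormD (z - (y + l *: (z - y))) (y + l *: (z - y) - x).
rewrite addrA subrK; have -> : z - (y + l *: (z - y)) = (1 - l) *: (z - y).
  by rewrite scalerBl scale1r opprD addrA.
have l1' : 0 <= 1 - l by rewrite subr_ge0.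
by rewrite !enormZ (ger0_norm l0) (ger0_norm l1'); have := zy x Ax; lra.
Qed.

Lemma sub_tube e x : A x -> 0 < e -> tube A e x.
Proof.
by move=> Ax e0; rewrite /tube /= (dist_closest (closest_self Ax)) subrr enorm0.
Qed.

Variable e : R.
Hypothesis e_reach : (e%:E < reach A)%E.

(** As [reach] is a supremum, some admissible radius [rho] exceeds [e]. *)
Lemma tube_unique_closest z : tube A e z -> exists! y, is_closest A z y.
Proof.
move: e_reach => /ereal_sup_gt[_ [rho uniq_closest <-]]; rewrite lte_fin => e_rho ze.
by apply: uniq_closest; exact: lt_trans e_rho.
Qed.

Lemma closest_pointP z : tube A e z -> is_closest A z (closest_point A z).
Proof.
by move=> /tube_unique_closest[y [zy _]]; exact: (xgetPex z (ex_intro _ y zy)).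
Qed.

Lemma closest_pointE z y : is_closest A z y -> enorm (z - y) < e ->
  tube A e z /\ closest_point A z = y.
Proof.
move=> zy zy_e; have ze : tube A e z by rewrite /tube /= (dist_closest zy).
split=> //; have [y' [_ uniq]] := tube_unique_closest ze.
by rewrite -(uniq _ zy) -(uniq _ (closest_pointP ze)).
Qed.

Lemma closest_point_lt z : tube A e z -> enorm (z - closest_point A z) < e.
Proof. by move=> ze; rewrite -(dist_closest (closest_pointP ze)). Qed.

Lemma tube_lt z x : A x -> enorm (z - x) < e -> tube A e z.
Proof. by move=> Ax; exact: le_lt_trans (dist_le _ Ax). Qed.

Lemma closest_point_id x : 0 < e -> A x -> closest_point A x = x.
Proof.
move=> e0 Ax; have [] // := closest_pointE (closest_self Ax).
by rewrite subrr enorm0.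
Qed.

Lemma open_tube : open (tube A e).
Proof.
rewrite openE => z ze; have [Ay _] := closest_pointP ze.
have zy := closest_point_lt ze; set y := closest_point A z in Ay zy.
(* Balls are taken in the sup norm, so the Euclidean margin is divided by a comparison constant;
   [n.+1] is nonzero for every [n]. *)
apply/nbhs_ballP; exists ((e - enorm (z - y)) / n.+1%:R).
  by rewrite /= divr_gt0 ?subr_gt0.
move=> w; rewrite -ball_normE /= ltr_pdivlMr // => zw.
apply: (tube_lt Ay); rewrite -(subrK z w) -addrA.
apply: le_lt_trans (ler_enormD _ _) _; rewrite -ltrBrDr.
apply: le_lt_trans (enorm_le_norm _) _; apply: le_lt_trans zw.
by rewrite distrC mulrC ler_wpM2l // ler_nat.
Qed.

Lemma tube_near z : tube A e z -> \forall w \near z, tube A e w.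
Proof. by move=> ze; exact: (open_nbhs_nbhs (conj open_tube ze)). Qed.

End closest_points.

Lemma norm_signed_dist (R : realType) n (Omega : set 'rV[R]_n) z :
  `|signed_dist Omega z| = dist (boundary Omega) z.
Proof.
by rewrite /signed_dist; case: ifP => _; [rewrite normrN|]; exact/ger0_norm/dist_ge0.
Qed.

Lemma near_curve (R : realType) n (gamma : R -> 'rV[R]_n) v (Q : set 'rV[R]_n) :
  is_derive (0 : R) (1 : R) gamma v -> nbhs (gamma 0) Q ->
  \forall s \near (0 : R), Q (gamma s).
Proof.
by move=> [/derivable1_diffP/differentiable_continuous + _] gQ; apply.
Qed.

Lemma near_line (R : realType) n (z w : 'rV[R]_n) (Q : set 'rV[R]_n) :
  nbhs z Q -> \forall s \near (0 : R), Q (z + s *: w).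
Proof.
by move=> zQ; apply: (near_curve (is_derive_line z w)); rewrite scale0r addr0.
Qed.

(** * The closest point map near a surface *)

Section closest_point_map.
Variables (R : realType) (n : nat) (A : set 'rV[R]_n) (e : R).
Hypotheses (n_gt0 : (0 < n)%N) (e_reach : (e%:E < reach A)%E).
Notation P := (closest_point A).
Hypothesis P_diff : forall z, tube A e z -> differentiable P z.
Variables (t : 'rV[R]_n -> 'I_n.-1 -> 'rV[R]_n) (sigma : 'rV[R]_n -> 'I_n.-1 -> R).
Hypothesis t_orth : forall z, tube A e z ->
  forall i j, dot (t z i) (t z j) = (i == j)%:R.
Hypothesis sigma_gt0 : forall z, tube A e z -> forall i, 0 < sigma z i.
Hypothesis jacP : forall z, tube A e z ->
  'J P z = \sum_i sigma z i *: tensor (t z i) (t z i).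

Lemma diff_closest z w : tube A e z ->
  'd P z w = \sum_i (sigma z i * dot w (t z i)) *: t z i.
Proof.
move=> ze; rewrite -deriveE; last exact: P_diff.
rewrite deriveEjacobian; last exact: P_diff.
rewrite jacP // mulmx_sumr; apply: eq_bigr => i _.
by rewrite -scalemxAr tensor_mul scalerA.
Qed.

Lemma diff_closest_frame z i : tube A e z ->
  'd P z (t z i) = sigma z i *: t z i.
Proof.
move=> ze; rewrite diff_closest // (bigD1 i) //= big1 ?addr0.
  by rewrite t_orth // eqxx mulr1.
by move=> j ji; rewrite t_orth // eq_sym (negbTE ji) mulr0 scale0r.
Qed.

(** Projecting a straight line through [z] yields a curve in [A]; this is how tangent vectors of [A]
    are produced. *)
Lemma curve_closest z w : tube A e z ->
  curve_at A (P z) ('d P z w) (fun s => P (z + s *: w)).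
Proof.
move=> ze; split; first by rewrite scale0r addr0.
- apply: (@near_line _ _ z w [set y | A (P y)]).
  by apply: filterS (tube_near e_reach ze) => y /(closest_pointP e_reach)[].
- exact/is_derive_comp_line/P_diff.
Qed.

(** All [sigma z i] are positive, so ['d P z] maps the span of the frame onto itself: dividing the
    coefficients by [sigma z i] gives a preimage, and the projected line in that direction is the
    required curve. *)
Lemma tangent_span z (a : 'I_n.-1 -> R) : tube A e z ->
  tangent A (P z) (\sum_i a i *: t z i).
Proof.
move=> ze; exists (fun s => P (z + s *: \sum_i ((sigma z i)^-1 * a i) *: t z i)).
suff <- : 'd P z (\sum_i ((sigma z i)^-1 * a i) *: t z i) = \sum_i a i *: t z i.
  exact: curve_closest.
rewrite linear_sum; apply: eq_bigr => i _.
rewrite linearZ /= diff_closest_frame // scalerA mulrAC mulVf ?mul1r //.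
by rewrite gt_eqF // sigma_gt0.
Qed.

Lemma tangent_frame z i : tube A e z -> tangent A (P z) (t z i).
Proof.
move=> ze; have := tangent_span (fun j => (i == j)%:R) ze.
rewrite (bigD1 i) //= eqxx scale1r big1 ?addr0 // => j.
by rewrite eq_sym => /negbTE ->; rewrite scale0r.
Qed.

(** Along a curve in [A] through [P z] the squared distance to [z] is minimal at [P z]; its
    derivative there is -2 times the product. *)
Lemma closest_perp z v : tube A e z -> tangent A (P z) v -> dot (z - P z) v = 0.
Proof.
move=> ze [gamma [g0 gA dg]].
have d1 : is_derive (0 : R) (1 : R) (fun s => z - gamma s) (- v).
  have := is_deriveB (is_derive_cst z (0 : R) (1 : R)) dg.
  by rewrite sub0r.
have := local_min_derive0 _ (is_derive_dot d1 d1).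
rewrite /= g0 dotNl dotNr (dotC v) => h.
suff : - dot (z - P z) v - dot (z - P z) v = 0 by move=> ?; lra.
apply: h; have [_ zP] := closest_pointP e_reach ze.
apply: filterS gA => s /zP.
by rewrite -!sqr_enorm ler_pXn2r ?nnegrE ?enorm_ge0.
Qed.

(** * The closest point map along normal lines *)

Section lipschitz_normal.
Variable N : 'rV[R]_n -> 'rV[R]_n.
Hypothesis N_unit : forall x, A x -> dot (N x) (N x) = 1.
Hypothesis N_perp : forall x v, A x -> tangent A x v -> dot (N x) v = 0.
Hypothesis N_lip : forall x, A x -> exists L d : R, [/\ 0 < L, 0 < d &
  forall y, A y -> `|y - x| < d -> `|N y - N x| <= L * `|y - x|].

(** The frame at [z] is also tangent to [A] at the foot point, so [N (P z)] completes it to an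
    orthonormal basis. *)
Lemma normal_decomp z v : tube A e z ->
  v = \sum_i dot v (t z i) *: t z i + dot v (N (P z)) *: N (P z).
Proof.
move=> ze; have [PA _] := closest_pointP e_reach ze.
apply: (orthonormal_decomp n_gt0 (t_orth ze) (N_unit PA)) => i.
exact: (N_perp PA (tangent_frame i ze)).
Qed.

Lemma closest_normal z : tube A e z ->
  z - P z = dot (z - P z) (N (P z)) *: N (P z).
Proof.
move=> ze; rewrite {1}(normal_decomp (z - P z) ze) big1 ?add0r // => i _.
have tt := tangent_frame i ze.
by rewrite (closest_perp ze tt) scale0r.
Qed.

Lemma diff_closest_normal z : tube A e z -> 'd P z (N (P z)) = 0.
Proof.
move=> ze; have [PA _] := closest_pointP e_reach ze.
rewrite diff_closest // big1 // => i _.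
have tt := tangent_frame i ze.
by rewrite (N_perp PA tt) mulr0 scale0r.
Qed.

Lemma enorm_normal x : A x -> enorm (N x) = 1.
Proof. by move=> Ax; rewrite /enorm N_unit // sqrtr1. Qed.

Lemma norm_normal x : A x -> `|N x| <= 1.
Proof. by move=> Ax; rewrite -(enorm_normal Ax) norm_le_enorm. Qed.

(* Put z = x + s N x, z_h = z + h N x, y = P z_h and z_h = y + c N y.
   Then c >= s, so w = y + s N y lies on [y, z_h] and P w = y, whence
   y - x = 'd P z (w - z) + o(w - z).  Up to a multiple of N x, on which 'd P z
   vanishes, w - z is (s - c) (N y - N x) = O(h |y - x|), while
   |w - z| = O(|y - x|); so |y - x| <= (O(h) + o(1)) |y - x| and y = x. *)
Lemma closest_normal_step x (s : R) : A x -> 0 <= s ->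
  tube A e (x + s *: N x) -> P (x + s *: N x) = x ->
  \forall h \near (0 : R), 0 <= h -> P (x + (s + h) *: N x) = x.
Proof.
move=> Ax s0; set z := x + s *: N x => ze Pz; set v := N x in z ze Pz *.
have v1 : `|v| <= 1 by exact: norm_normal.
have [L [dL [L0 dL0 NL]]] := N_lip Ax.
have n0 : 1 <= n%:R :> R by rewrite ler1n.
(* [M] is such that |c - (s + h)| <= M |y - x|. The expansion of [P] with tolerance [M^-1] gives |y
   - x| <= h / M, hence c >= s. *)
pose M : R := n%:R * (1 + (s + 1) * L).
have M1 : 1 <= M.
  by rewrite /M -[leLHS]mulr1 ler_pM // lerDl mulr_ge0 ?addr_ge0 // ltW.
have M0 : 0 < M by lra.
have Mi0 : 0 < M^-1 by rewrite invr_gt0.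
have Mi1 : M^-1 <= 1 by rewrite invf_le1.
have zdiff := P_diff ze.
have [d1 d10 step1] := differentiable_expansion zdiff Mi0.
(* [K] is such that |w - z| <= K |y - x|, so the tolerance below leaves a remainder of at most |y -
   x| / 4. The bound 8 D L h < 1 imposed on [h] later makes the linear term at most |y - x| / 4
   too. *)
pose K := 1 + s * L; have K0 : 0 < K by rewrite ltr_pwDl // mulr_ge0 // ltW.
have K40 : 0 < (4 * K)^-1 by rewrite invr_gt0 mulr_gt0.
have [d2 d20 step2] := differentiable_expansion zdiff K40.
have [D D0 dPD] := linear_lipschitz (diff_continuous zdiff).
have DL0 : 0 < D * L by exact: mulr_gt0.
have dPv : 'd P z v = 0 by have := diff_closest_normal ze; rewrite Pz.
near=> h => h0.
have nh : `|h| = h by rewrite ger0_norm.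
have hd1 : h < d1 by near: h; exact: lt_nbhsl.
have h1 : h < 1 by near: h; exact: lt_nbhsl.
have hdL : h < dL by near: h; exact: lt_nbhsl.
have hd2 : K * h < d2.
  by rewrite -ltr_pdivlMl //; near: h; apply: lt_nbhsl; rewrite mulr_gt0 ?invr_gt0.
have hDL : 8 * (D * L) * h < 1.
  rewrite -ltr_pdivlMl ?mulr_gt0 // mulr1; near: h; apply: lt_nbhsl.
  by rewrite invr_gt0 mulr_gt0.
have zhE : x + (s + h) *: v = z + h *: v by rewrite scalerDl addrA.
rewrite zhE; set zh := z + h *: v; set y := P zh.
have zhe : tube A e zh.
  rewrite /zh; near: h.
  exact: (@near_line _ _ z v (tube A e) (tube_near e_reach ze)).
have [Ay zhy] : is_closest A zh y := closest_pointP e_reach zhe.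
have Ny1 : `|N y| <= 1 by exact: norm_normal.
have hv : `|h *: v| <= h by rewrite normrZ nh; nra.
have yx : `|y - x| <= M^-1 * h.
  have := step1 _ (le_lt_trans hv hd1).
  rewrite Pz linearZ /= dPv.
  by rewrite scaler0 subr0 => /le_trans; apply; rewrite ler_pM2l.
have yxh : `|y - x| <= h by apply: le_trans yx _; nra.
have Nyx : `|N y - v| <= L * `|y - x|.
  by apply: NL => //; exact: le_lt_trans hdL.
pose c := dot (zh - y) (N y).
have zhyE : zh - y = c *: N y by exact: closest_normal.
have cE : c - (s + h) = (s + h) * dot v (N y - v) - dot (y - x) (N y).
  rewrite /c; have -> : zh - y = (s + h) *: v - (y - x).
    by apply/rowP => i; rewrite /zh /z !mxE; ring.
  by rewrite [in LHS]dotBl dotZl dotBr [dot v v](N_unit Ax); ring.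
have cM : `|c - (s + h)| <= h.
  apply: (@le_trans _ _ (M * `|y - x|)); last by rewrite -ler_pdivlMl.
  rewrite cE (le_trans (ler_normB _ _)) // normrM (ger0_norm (addr_ge0 s0 h0)).
  have q1 := dot_le_norm v (N y - v); have q2 := dot_le_norm (y - x) (N y).
  have q1' : `|dot v (N y - v)| <= n%:R * (L * `|y - x|).
    apply: le_trans q1 _; rewrite -mulrA ler_wpM2l // (le_trans _ Nyx) //.
    by rewrite ler_piMl.
  have q2' : `|dot (y - x) (N y)| <= n%:R * `|y - x|.
    by apply: le_trans q2 _; rewrite ler_piMr // mulr_ge0.
  have -> : M * `|y - x| = (s + 1) * (n%:R * (L * `|y - x|)) + n%:R * `|y - x|.
    by rewrite /M; ring.
  by rewrite lerD // ler_pM // ?addr_ge0 // lerD2l ltW.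
have [cs cs2] : 0 <= c - s /\ c - s <= 2 * h.
  by move: cM; rewrite ler_norml; lra.
have zhy_closest : is_closest A (y + s *: N y) y.
  (* If [c = 0] then [s = 0] and the point is [y] itself; otherwise it divides the segment from [y]
     to [zh] in the ratio [s / c <= 1]. *)
  have [c0|c0] := eqVneq c 0.
    have -> : s = 0 by lra.
    by rewrite scale0r addr0; exact: closest_self.
  have c_gt0 : 0 < c by rewrite lt_neqAle eq_sym c0; lra.
  have := @closest_segment _ _ A zh y (s / c) (conj Ay zhy).
  rewrite zhyE scalerA divfK //; apply.
  by rewrite divr_ge0 ?ler_pdivrMr // ?mul1r; lra.
set w := y + s *: N y.
have Pw : P w = y.
  have := closest_pointE e_reach zhy_closest.
  case=> //; have -> : w - y = s *: N y by rewrite /w addrC addKr.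
  have := closest_point_lt e_reach zhe; rewrite -/y zhyE !enormZ enorm_normal //.
  by rewrite !mulr1 !ger0_norm; lra.
have wzE : w - z = (y - x) + s *: (N y - v).
  by rewrite /w /z scalerBr opprD addrACA.
have wz_le : `|w - z| <= K * `|y - x|.
  rewrite wzE (le_trans (ler_normD _ _)) // normrZ ger0_norm // /K mulrDl mul1r.
  by rewrite lerD2l -mulrA ler_wpM2l.
have wz_lt : `|w - z| < d2.
  by apply: le_lt_trans hd2; apply: le_trans wz_le _; rewrite ler_pM2l.
(* The first expression of [w - z] controls its size; this one isolates a multiple of [v], which
   ['d P z] annihilates. *)
have wzE' : w - z = (s + h - c) *: v - (c - s) *: (N y - v).
  have -> : w - z = w - zh + h *: v by apply/rowP => i; rewrite /zh !mxE; ring.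
  have -> : w - zh = (s - c) *: N y.
    have -> : zh = y + c *: N y by rewrite -zhyE addrC subrK.
    by rewrite /w opprD addrACA subrr add0r scalerBl.
  by apply/rowP => i; rewrite !mxE; ring.
have := step2 _ wz_lt; rewrite [z + _]addrC subrK Pw Pz => est.
have dwz : `|'d P z (w - z)| <= D * (2 * h * (L * `|y - x|)).
  rewrite wzE' linearB /= [X in `|X - _|]linearZ /=.
  rewrite dPv scaler0 sub0r normrN (le_trans (dPD _)) // ler_pM2l // normrZ.
  by rewrite ger0_norm // ler_pM.
suff : `|y - x| <= 0 by rewrite normr_le0 subr_eq0 => /eqP.
have yx_le : `|y - x| <= D * (2 * h * (L * `|y - x|)) + 4^-1 * `|y - x|.
  rewrite -{1}(subrK ('d P z (w - z)) (y - x)) addrC.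
  rewrite (le_trans (ler_normD _ _)) // lerD // (le_trans est) //.
  by rewrite invfM -mulrA ler_pM2l // ler_pdivrMl // mulrC.
have : D * (2 * h * (L * `|y - x|)) <= 4^-1 * `|y - x|.
  have -> : D * (2 * h * (L * `|y - x|)) = (8 * (D * L) * h) / 4 * `|y - x|.
    by field.
  by rewrite ler_wpM2r //; lra.
have := normr_ge0 (y - x); lra.
Unshelve. all: by end_near. Qed.

(** Let [S] be the set of heights up to [s] whose foot point is still [x]. Its supremum belongs to
    [S] by continuity of [P], and [closest_normal_step] would push it further if it were below
    [s]. *)
Lemma closest_along_normal x (s : R) : A x -> 0 <= s -> s < e ->
  P (x + s *: N x) = x.
Proof.
move=> Ax s0 se; apply/eqP/negPn/negP => Ps.
have in_tube a : 0 <= a -> a < e -> tube A e (x + a *: N x).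
  move=> a0 ae; apply: (tube_lt Ax).
  rewrite [_ + _ *: _]addrC addrK enormZ ger0_norm //.
  by rewrite (enorm_normal Ax) mulr1.
have e0 : 0 < e by lra.
pose S := [set a | 0 <= a <= s /\ P (x + a *: N x) = x].
have S0 : S 0.
  by split; rewrite ?lexx //= scale0r addr0; exact: (closest_point_id e_reach).
have Ss : ubound S s by move=> a [/andP[_ ?] _].
have supS : has_sup S by split; [exists 0|exists s].
have m0 : 0 <= sup S by apply: ub_le_sup; [exists s|].
have ms : sup S <= s by apply: ge_sup => //; exists 0.
have mt : tube A e (x + sup S *: N x) by apply: in_tube => //; lra.
have Pm : P (x + sup S *: N x) = x.
  apply/eqP/negPn/negP => Pm.
  have [L [d [L0 d0 PL]]] := differentiable_lipschitz_at (P_diff mt).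
  pose q := `|x - P (x + sup S *: N x)|.
  have q0 : 0 < q by rewrite normr_gt0 subr_eq0 eq_sym.
  (* Elements of [S] closer to the supremum than [q / (2 * L)] have foot points within [q / 2] of
     that of the supremum, whereas they are all [x], at distance [q]. *)
  have d'0 : 0 < Num.min d (q / (2 * L)).
    by rewrite lt_min d0 divr_gt0 // mulr_gt0.
  have [a Sa da] := sup_adherent d'0 supS; have [/andP[a0 as_] Pa] := Sa.
  have am : a <= sup S by apply: ub_le_sup => //; exists s.
  have da1 : sup S - a < d.
    by rewrite ltrBlDr -ltrBlDl (le_lt_trans _ da) // lerB // ge_min lexx.
  have da2 : sup S - a < q / (2 * L).
    by rewrite ltrBlDr -ltrBlDl (le_lt_trans _ da) // lerB // ge_min lexx orbT.
  have ka : `|(a - sup S) *: N x| <= sup S - a.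
    rewrite normrZ distrC ger0_norm ?subr_ge0 // ler_piMr ?subr_ge0 //.
    exact: norm_normal.
  have := PL _ (le_lt_trans ka da1).
  have -> : x + sup S *: N x + (a - sup S) *: N x = x + a *: N x.
    by rewrite -addrA -scalerDl [sup S + _]addrC subrK.
  rewrite Pa -/q leNgt => /negP; apply.
  apply: le_lt_trans (_ : L * (q / (2 * L)) < q).
    by rewrite ler_pM2l // (le_trans ka) // ltW.
  have -> : L * (q / (2 * L)) = q / 2 by field; rewrite gt_eqF.
  by lra.
have ms' : sup S < s.
  by rewrite lt_neqAle ms andbT; apply: contraNneq Ps => <-; rewrite Pm.
have := closest_normal_step Ax m0 mt Pm.
move=> /nbhs_ballP[d /= d0 hd].
(* The first bound keeps [h] inside the ball of radius [d], the second keeps [sup S + h] at most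
   [s]. *)
pose h := Num.min (d / 2) (s - sup S).
have h0 : 0 < h by rewrite lt_min divr_gt0 //= subr_gt0.
have h1 : h <= d / 2 by rewrite ge_min lexx.
have h2 : h <= s - sup S by rewrite ge_min lexx orbT.
have hS : S (sup S + h).
  split; first by apply/andP; split; lra.
  apply: hd; last by lra.
  by rewrite -ball_normE /= sub0r normrN ger0_norm; lra.
have : sup S + h <= sup S by apply: ub_le_sup => //; exists s.
lra.
Qed.

End lipschitz_normal.

(** * Parallel surfaces and transport of test functions *)

Section C1_normal.
Variable N : 'rV[R]_n -> 'rV[R]_n.
Hypothesis N_unit : forall x, A x -> dot (N x) (N x) = 1.
Hypothesis N_perp : forall x v, A x -> tangent A x v -> dot (N x) v = 0.
Hypothesis N_C1 : C1_field_on A N.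

(** For negative [s], [- N] satisfies the same assumptions, and the previous result applies to it
    with [- s]. *)
Lemma closest_normal_line x (s : R) : A x -> `|s| < e -> P (x + s *: N x) = x.
Proof.
move=> Ax; have N_lip y (Ay : A y) := C1_field_lipschitz N_C1 Ay.
have [s0|s0] := leP 0 s => se.
  rewrite (ger0_norm s0) in se.
  exact: (closest_along_normal N_unit N_perp N_lip).
have := @closest_along_normal (fun y => - N y) _ _ _ x (- s) Ax.
rewrite scaleNr scalerN opprK; apply.
- by move=> y Ay; rewrite dotNl dotNr opprK N_unit.
- by move=> y v Ay Av; rewrite dotNl N_perp ?oppr0.
- move=> y /N_lip[L [d [L0 d0 NL]]]; exists L, d; split=> // w Aw wd.
  by rewrite -opprD normrN NL.
- by rewrite oppr_ge0 ltW.
- by rewrite -(ltr0_norm s0).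
Qed.

(** A signed distance whose sign comes from the side to which [N] points, without reference to a
    domain bounded by [A]. *)
Definition height z := dot (z - P z) (N (P z)).

Lemma heightE z : tube A e z -> z = P z + height z *: N (P z).
Proof.
move=> ze; rewrite /height -(closest_normal N_unit N_perp ze).
by rewrite addrC subrK.
Qed.

Lemma norm_height z : tube A e z -> `|height z| = dist A z.
Proof.
move=> ze; have PA := closest_pointP e_reach ze.
rewrite (dist_closest PA) {2}(heightE ze) addrC addKr enormZ.
by rewrite (enorm_normal N_unit) ?mulr1 //; case: PA.
Qed.

Lemma height_lt z : tube A e z -> `|height z| < e.
Proof. by move=> ze; rewrite norm_height. Qed.

Lemma tube_normal x (s : R) : A x -> `|s| < e -> tube A e (x + s *: N x).
Proof.
move=> Ax se; apply: (tube_lt Ax).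
by rewrite [_ + _ *: _]addrC addrK enormZ (enorm_normal N_unit) // mulr1.
Qed.

(* On the parallel surfaces at distance [dist A z0] the height is +- that of z0,
   and by continuity the sign cannot jump near z0. *)
Lemma parallel_near z0 : tube A e z0 -> \forall z \near z0,
  dist A z = dist A z0 -> z = P z + height z0 *: N (P z).
Proof.
move=> z0e; set c := height z0.
have [PA0 _] := closest_pointP e_reach z0e.
have [c0|c0] := eqVneq c 0.
  near=> z => dz; have ze : tube A e z by near: z; exact: tube_near.
  rewrite [LHS](heightE ze) c0; suff -> : height z = 0 by [].
  by apply/eqP; rewrite -normr_eq0 norm_height // dz -norm_height // -/c c0 normr0.
have [L [d [L0 d0 NL]]] := C1_field_lipschitz N_C1 PA0.
have [K [d' [K0 d'0 PK]]] := differentiable_lipschitz_at (P_diff z0e).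
pose M : R := n%:R * (1 + K + `|c| * (L * K)).
have M0 : 0 < M.
  have LK : 0 <= `|c| * (L * K) by rewrite !mulr_ge0 // ltW.
  by rewrite mulr_gt0 ?ltr0n //; lra.
near=> z => dz.
have ze : tube A e z by near: z; exact: tube_near.
have [PA _] := closest_pointP e_reach ze.
have zd' : `|z - z0| < d' by near: z; exact: near_norm_lt.
have zd : K * `|z - z0| < d.
  rewrite -ltr_pdivlMl //; near: z; apply: near_norm_lt.
  by rewrite mulr_gt0 // invr_gt0.
have zM : M * `|z - z0| < 2 * `|c|.
  rewrite -ltr_pdivlMl //; near: z; apply: near_norm_lt.
  by rewrite !mulr_gt0 ?invr_gt0 // normr_gt0.
have PPz : `|P z - P z0| <= K * `|z - z0|.
  by have := PK _ zd'; rewrite [z0 + _]addrC subrK.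
have NNz : `|N (P z) - N (P z0)| <= L * K * `|z - z0|.
  by rewrite (le_trans (NL _ PA (le_lt_trans PPz zd))) // -mulrA ler_pM2l.
rewrite [LHS](heightE ze); suff -> : height z = c by [].
have : `|height z| = `|c| by rewrite !norm_height.
(* If the height were [- c], the vector [2 c N (P z0)], of length 2|c|, would be a combination of
   increments between [z0] and [z]. The three summands of [M] bound these increments, and [z] is too
   close to [z0] for that. *)
move/eqP; rewrite eqr_norm2 => /orP[/eqP //|/eqP hz]; exfalso.
have := zM; apply/negP; rewrite -leNgt.
have -> : 2 * `|c| = enorm ((2 * c) *: N (P z0)).
  by rewrite enormZ (enorm_normal N_unit) // mulr1 normrM normr_nat.
have -> : (2 * c) *: N (P z0) =
    - (z - z0) + (P z - P z0) - c *: (N (P z) - N (P z0)).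
  have zE : z = P z - c *: N (P z) by rewrite {1}(heightE ze) hz scaleNr.
  have z0E : z0 = P z0 + c *: N (P z0) by exact: heightE.
  have -> : z - z0 = (P z - c *: N (P z)) - (P z0 + c *: N (P z0)).
    by rewrite -zE -z0E.
  by apply/rowP => i; rewrite !mxE; ring.
apply: le_trans (enorm_le_norm _) _; rewrite /M -mulrA ler_wpM2l //.
rewrite (le_trans (ler_normB _ _)) // !mulrDl mul1r lerD //.
  by rewrite (le_trans (ler_normD _ _)) // normrN lerD.
by rewrite normrZ -!mulrA ler_wpM2l // mulrA.
Unshelve. all: by end_near. Qed.

(** Locally the extension is [phi \o G] with [G] the translation along the extended normal field.
    The neighbourhood is cut down to the preimage of the tube, where [phi] is C^1. *)
Lemma C1_surface_parallel phi (c : R) : Ck 1 (tube A e) phi -> `|c| < e ->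
  C1_surface A (fun x => phi (x + c *: N x)).
Proof.
move=> phi1 ce x Ax; have [U [F [Uo Ux F1 NF]]] := N_C1 Ax.
pose G y := y + c *: F y.
have Gi i : Ck 1 U (fun y => G y 0 i).
  have -> : (fun y => G y 0 i) = (fun y => y 0 i + cst c y * F y 0 i).
    by apply/funext => y; rewrite !mxE.
  apply: (Ck1_add Uo); first exact: Ck1_coord.
  by apply: (Ck1_mul Uo); first exact: Ck1_cst.
have Gc y : U y -> {for y, continuous G}.
  move=> Uy; apply/differentiable_continuous/rV_differentiable => i.
  by have [dGi _] := Gi i; exact: dGi.
pose V := U `&` G @^-1` tube A e.
have Vo : open V.
  rewrite openE => y [Uy Gy]; apply: filterI; first exact: open_nbhs_nbhs.
  exact: (Gc y Uy _ (tube_near e_reach Gy)).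
exists V, (phi \o G); split=> //.
- split=> //; rewrite /preimage /= /G -NF //.
  exact: tube_normal.
- apply: (Ck1_comp Vo phi1) => [i|y [_]//].
  have [d1 d2] := Gi i; split=> [y [Uy _]|w y [Uy _]]; first exact: d1.
  exact: d2.
- by move=> y Ay [Uy _]; rewrite /= /G NF.
Qed.

(** Existence of a surface gradient, so that [xget] does not fall back on its default 0. The witness
    is the tangential part of the gradient of a local extension; velocities of curves in [A] have no
    normal component. *)
Lemma surface_gradP psi z : C1_surface A psi -> tube A e z ->
  is_surface_grad A psi (P z) (surface_grad A psi (P z)).
Proof.
move=> psi1 ze; have [PA _] := closest_pointP e_reach ze.
have [U [F [Uo UP [dF _] psiF]]] := psi1 _ PA.
apply: (xgetPex 0); exists (\sum_i dot (grad F (P z)) (t z i) *: t z i).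
split; first exact: tangent_span.
move=> v gamma gv; have [g0 gA dg] := gv.
have Nv : dot (N (P z)) v = 0 by apply: N_perp => //; exists gamma.
have -> : dot (\sum_i dot (grad F (P z)) (t z i) *: t z i) v = 'd F (P z) v.
  rewrite diff_grad; last exact: dF.
  rewrite {2}(normal_decomp N_unit N_perp v ze).
  rewrite (dotC v (N _)) Nv scale0r addr0 dotC [RHS]dotC !dot_suml.
  by rewrite dotC dot_suml; apply: eq_bigr => i _;
    rewrite !dotZl (dotC v) dotC mulrC.
have dFg : differentiable F (gamma 0) by rewrite g0; exact: dF.
have := is_derive_comp_diff dg dFg; rewrite g0; apply: near_eq_is_derive.
have gU : \forall s \near (0 : R), U (gamma s).
  by apply: (near_curve dg); rewrite g0; exact: open_nbhs_nbhs.
near=> s; rewrite /= psiF //; near: s; [exact: gA|exact: gU].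
Unshelve. all: by end_near. Qed.

Hypothesis t_parallel : forall z, tube A e z -> forall i,
  tangent [set y | dist A y = dist A z] z (t z i).

(** [P] sends a curve in the parallel surface with velocity [t z i] to a curve in [A] with velocity
    [sigma z i *: t z i]. Along it the transported function takes the values of [phi] on the
    original curve; comparing the two derivatives gives each coefficient. *)
Lemma surface_grad_parallel phi z : Ck 1 (tube A e) phi -> tube A e z ->
  surface_grad A (fun x => phi (x + height z *: N x)) (P z) =
  \sum_i ((sigma z i)^-1 * dot (grad phi z) (t z i)) *: t z i.
Proof.
move=> phi1 ze; have [PA _] := closest_pointP e_reach ze.
have he : `|height z| < e by exact: height_lt.
set psi := fun x => _; have psi1 : C1_surface A psi by exact: C1_surface_parallel.
have [p_tan pE] := surface_gradP psi1 ze; set p := surface_grad _ _ _ in p_tan pE *.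
rewrite (normal_decomp N_unit N_perp p ze).
rewrite (dotC p (N _)) (N_perp PA p_tan) scale0r addr0; apply: eq_bigr => i _.
congr (_ *: _).
have [gamma [g0 gS dg]] := t_parallel ze i.
have dphi : differentiable phi (gamma 0) by rewrite g0; exact: (phi1.1 z ze).
have dPg : differentiable P (gamma 0) by rewrite g0; exact: P_diff.
have gnear (Q : set 'rV[R]_n) (zQ : nbhs z Q) : \forall s \near (0 : R), Q (gamma s).
  by apply: (near_curve dg); rewrite g0.
have Pg : curve_at A (P z) (sigma z i *: t z i) (P \o gamma).
  split; first by rewrite /= g0.
    have := gnear _ (tube_near e_reach ze); apply: filterS => s.
    by move=> /(closest_pointP e_reach)[].
  have := is_derive_comp_diff dg dPg.
  by rewrite g0 diff_closest_frame.
have d1 := pE _ _ Pg; have d2 := is_derive_comp_diff dg dphi.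
have d3 : is_derive (0 : R) (1 : R) (psi \o (P \o gamma)) ('d phi (gamma 0) (t z i)).
  apply: near_eq_is_derive d2.
  have near_z := parallel_near ze.
  near=> s; rewrite /= /psi; congr phi.
  suff : dist A (gamma s) = dist A z.
    by near: s; exact: gnear near_z.
  by near: s; exact: gS.
have := is_derive_unique d1 d3.
rewrite diff_grad // g0 dotZr => <-.
by rewrite mulrA mulVf ?mul1r // gt_eqF // sigma_gt0.
Unshelve. all: by end_near. Qed.

(** The foot point is constant on the normal line near [z], so [phi] has a one-dimensional extremum
    there. Comparing only points with the same foot point is what survives after the values of
    [u \o P] cancel. *)
Lemma normal_critical (phi : 'rV[R]_n -> R) z : tube A e z -> differentiable phi z ->
  (\forall w \near z, P w = P z -> phi z <= phi w) \/
  (\forall w \near z, P w = P z -> phi w <= phi z) ->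
  dot (grad phi z) (N (P z)) = 0.
Proof.
move=> ze dphi ext; have [PA _] := closest_pointP e_reach ze.
set v := N (P z).
have he : `|height z| < e by exact: height_lt.
have Pline : \forall s \near (0 : R), P (z + s *: v) = P z.
  have he' : 0 < e - `|height z| by rewrite subr_gt0.
  near=> s.
  rewrite {1}(heightE ze).
  rewrite -addrA -scalerDl; apply: closest_normal_line => //.
  rewrite (le_lt_trans (ler_normD _ _)) // -ltrBrDl.
  by near: s; exact: (@nbhs0_lt R R).
have d0 := is_derive_comp_line v dphi; rewrite -diff_grad //.
case: ext => ext.
  apply: local_min_derive0 d0.
  near=> s; rewrite scale0r addr0.
  have : P (z + s *: v) = P z by near: s.
  by near: s; exact: (@near_line _ _ z v [set w | P w = P z -> phi z <= phi w] ext).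
(* A local maximum is treated as a local minimum of the opposite function. *)
have d0' := is_deriveN d0.
apply/eqP; rewrite -oppr_eq0; apply/eqP; apply: local_min_derive0 d0'.
near=> s; rewrite /= !fctE scale0r addr0 lerN2.
have : P (z + s *: v) = P z by near: s.
by near: s; exact: (@near_line _ _ z v [set w | P w = P z -> phi w <= phi z] ext).
Unshelve. all: by end_near. Qed.

(** Being orthogonal to the frame, [nu] is a multiple of [N (P z)]; the gradient has no component
    along it, so the [mu] term vanishes. *)
Lemma tensorB_grad (phi : 'rV[R]_n -> R) z (nu : 'rV[R]_n) mu : tube A e z ->
  (forall i, dot nu (t z i) = 0) -> dot (grad phi z) (N (P z)) = 0 ->
  grad phi z *m (tensorB (t z) nu (sigma z) mu)^T =
  \sum_i ((sigma z i)^-1 * dot (grad phi z) (t z i)) *: t z i.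
Proof.
move=> ze nut gN; rewrite /tensorB linearD /= linear_sum /= mulmxDr mulmx_sumr.
rewrite [X in _ + X](_ : _ = 0) ?addr0.
  by apply: eq_bigr => i _;
    rewrite linearZ /= -scalemxAr tr_tensor tensor_mul scalerA.
rewrite linearZ /= -scalemxAr tr_tensor tensor_mul.
have := normal_decomp N_unit N_perp nu ze.
rewrite big1 ?add0r => [nuE|i _]; last by rewrite nut scale0r.
by rewrite {1}nuE dotZr gN mulr0 scale0r scaler0.
Qed.

Lemma surface_grad_extremum (phi : 'rV[R]_n -> R) z (nu : 'rV[R]_n) mu :
  Ck 1 (tube A e) phi -> tube A e z -> (forall i, dot nu (t z i) = 0) ->
  (\forall w \near z, P w = P z -> phi z <= phi w) \/
  (\forall w \near z, P w = P z -> phi w <= phi z) ->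
  surface_grad A (fun x => phi (x + height z *: N x)) (P z) =
  grad phi z *m (tensorB (t z) nu (sigma z) mu)^T.
Proof.
move=> phi1 ze nut ext; rewrite surface_grad_parallel // tensorB_grad //.
by apply: normal_critical => //; exact: (proj1 phi1 z ze).
Qed.

(** Translation along the normals by the height of [z] is continuous on [A] and sends [P z] to [z];
    it turns local extrema at [z] into local extrema at [P z]. *)
Lemma parallel_continuous (z : 'rV[R]_n) (Q : set 'rV[R]_n) :
  tube A e z -> nbhs z Q ->
  \forall x \near P z, A x -> Q (x + height z *: N x).
Proof.
move=> ze zQ; have [PA _] := closest_pointP e_reach ze.
have [U [F [Uo Ux F1 NF]]] := N_C1 PA.
have Gc : {for P z, continuous (fun y : 'rV[R]_n => y + height z *: F y)}.
  apply/differentiable_continuous/differentiableD => //.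
  apply/differentiableZ/rV_differentiable => i.
  by have [dFi _] := F1 i; exact: dFi.
have zE : P z + height z *: F (P z) = z.
  by rewrite -NF // -(heightE ze).
have GQ : \forall x \near P z, Q (x + height z *: F x).
  by apply: Gc; rewrite zE.
near=> x => Ax; have Ux' : U x by near: x; exact: open_nbhs_nbhs.
by rewrite NF //; near: x.
Unshelve. all: by end_near. Qed.

End C1_normal.

End closest_point_map.

(** * The outward normal field *)

(** Two derivatives of [rho] are kept, which makes its normalized gradient C^1. *)
Definition defining_function (R : realType) n (Omega U : set 'rV[R]_n)
    (rho : 'rV[R]_n -> R) : Prop :=
  [/\ open U, Ck 2 U rho, (forall y, U y -> grad rho y != 0) &
      forall y, U y -> (Omega y <-> rho y < 0) /\
                       (boundary Omega y <-> rho y = 0)].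

Definition unit_grad (R : realType) n (rho : 'rV[R]_n -> R) x :=
  (enorm (grad rho x))^-1 *: grad rho x.

(** A choice among all local defining functions. At boundary points the value does not depend on it,
    by [unit_grad_unique], so the local fields glue. *)
Definition outward_normal (R : realType) n (Omega : set 'rV[R]_n)
    (x : 'rV[R]_n) : 'rV[R]_n :=
  xget 0 [set v | exists U rho,
    [/\ defining_function Omega U rho, U x & v = unit_grad rho x]].

Lemma derive_gt0_near (R : realType) (f : R -> R) a :
  is_derive (0 : R) (1 : R) f a -> f 0 = 0 -> 0 < a ->
  \forall s \near (0 : R), 0 < s -> 0 < f s.
Proof.
move=> [df fa] f0 a0; have a2 : 0 < a / 2 by rewrite divr_gt0.
have df' := df; move/derivable1_diffP : df' => df'.
have [d d0 hd] := differentiable_expansion df' a2.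
apply/nbhs_ballP; exists d => // s; rewrite -ball_normE /= sub0r normrN => sd s0.
have := hd s sd; rewrite add0r f0 subr0 deriv1E // derive1E fa.
rewrite -[s *: a]/(s * a) (gtr0_norm s0) ler_norml => /andP[+ _].
have : 0 < a * s by rewrite mulr_gt0.
lra.
Qed.

Section defining_functions.
Variables (R : realType) (n : nat) (Omega : set 'rV[R]_n).
Notation A := (boundary Omega).

Lemma defining_diff U rho x : defining_function Omega U rho -> U x ->
  differentiable rho x.
Proof. by move=> [_ [+ _] _ _] => /[apply]. Qed.

Lemma enorm_grad_gt0 U rho x : defining_function Omega U rho -> U x ->
  0 < enorm (grad rho x).
Proof.
move=> [_ _ g0 _] Ux; rewrite lt_neqAle enorm_ge0 andbT eq_sym enorm_eq0.
exact: g0.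
Qed.

Lemma unit_grad_unit U rho x : defining_function Omega U rho -> U x ->
  dot (unit_grad rho x) (unit_grad rho x) = 1.
Proof.
move=> rhoU Ux; have g0 := enorm_grad_gt0 rhoU Ux.
rewrite /unit_grad dotZl dotZr -sqr_enorm; field.
by rewrite gt_eqF.
Qed.

(** [rho] vanishes along every curve in the boundary, so its derivative along the velocity is 0. *)
Lemma unit_grad_perp U rho x v : defining_function Omega U rho -> U x -> A x ->
  tangent A x v -> dot (unit_grad rho x) v = 0.
Proof.
move=> rhoU Ux Ax [gamma [g0 gA dg]]; have [Uo _ _ rhoE] := rhoU.
have drho : differentiable rho (gamma 0) by rewrite g0; exact: defining_diff rhoU _.
have d1 := is_derive_comp_diff dg drho.
have d2 : is_derive (0 : R) (1 : R) (rho \o gamma) 0.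
  apply: near_eq_is_derive (is_derive_cst (0 : R) (0 : R) (1 : R)).
  have gU : \forall s \near (0 : R), U (gamma s).
    by apply: (near_curve dg); rewrite g0; exact: open_nbhs_nbhs.
  near=> s; have Us : U (gamma s) by near: s.
  by apply/esym/(proj2 (rhoE _ Us)); near: s.
have := is_derive_unique d1 d2; rewrite diff_grad // g0 /unit_grad dotZl => ->.
by rewrite mulr0.
Unshelve. all: by end_near. Qed.

Lemma unit_grad_C1 U rho i : defining_function Omega U rho ->
  Ck 1 U (fun y => unit_grad rho y 0 i).
Proof.
move=> rhoU; have [Uo [_ Drho] _ _] := rhoU.
have -> : (fun y => unit_grad rho y 0 i) = (fun y =>
    (Num.sqrt (\sum_j 'D_(delta_mx 0 j) rho y * 'D_(delta_mx 0 j) rho y))^-1 *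
    'D_(delta_mx 0 i) rho y).
  apply/funext => y; rewrite /unit_grad /enorm dotE !mxE; congr (_^-1 * _).
  by congr Num.sqrt; apply: eq_bigr => j _; rewrite !mxE.
have gE y : \sum_j 'D_(delta_mx 0 j) rho y * 'D_(delta_mx 0 j) rho y =
    dot (grad rho y) (grad rho y).
  by rewrite dotE; apply: eq_bigr => j _; rewrite !mxE.
have g0 y : U y ->
    0 < \sum_j 'D_(delta_mx 0 j) rho y * 'D_(delta_mx 0 j) rho y.
  by move=> Uy; rewrite gE -sqr_enorm exprn_gt0 // (enorm_grad_gt0 rhoU).
apply: (Ck1_mul Uo); last exact: Drho.
apply: (Ck1_inv Uo) => [|y Uy]; last by rewrite gt_eqF // sqrtr_gt0 g0.
apply: (Ck1_sqrt Uo) => //; apply: (Ck1_sum Uo) => j.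
by apply: (Ck1_mul Uo); exact: Drho.
Qed.

Hypothesis n_gt0 : (0 < n)%N.
Variable (t : 'rV[R]_n -> 'I_n.-1 -> 'rV[R]_n).
Hypothesis t_orth : forall x, A x ->
  forall i j, dot (t x i) (t x j) = (i == j)%:R.
Hypothesis t_tangent : forall x i, A x -> tangent A x (t x i).

(* Two unit normals agree up to sign, and the sign is determined by the side on
   which Omega lies. *)
Lemma unit_grad_unique U1 rho1 U2 rho2 x : A x ->
  defining_function Omega U1 rho1 -> U1 x ->
  defining_function Omega U2 rho2 -> U2 x ->
  unit_grad rho1 x = unit_grad rho2 x.
Proof.
move=> Ax rhoU1 U1x rhoU2 U2x.
set n1 := unit_grad rho1 x; set n2 := unit_grad rho2 x.
have n2_unit : dot n2 n2 = 1 by exact: unit_grad_unit rhoU2 U2x.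
have n1_unit : dot n1 n1 = 1 by exact: unit_grad_unit rhoU1 U1x.
have n2t i : dot n2 (t x i) = 0.
  by apply: (unit_grad_perp rhoU2) => //; exact: t_tangent.
have n1t i : dot n1 (t x i) = 0.
  by apply: (unit_grad_perp rhoU1) => //; exact: t_tangent.
have := orthonormal_decomp n_gt0 (t_orth Ax) n2_unit n2t n1.
rewrite big1 ?add0r => [n12|i _]; last by rewrite n1t scale0r.
have /eqP : dot n1 n2 ^+ 2 = 1.
  by rewrite -n1_unit {2 3}n12 dotZl dotZr n2_unit mulr1.
rewrite sqrf_eq1 => /orP[/eqP a1|/eqP a1]; first by rewrite n12 a1 scale1r.
(* With opposite normals, moving from [x] along [n1] increases [rho1] and decreases [rho2]: the
   points reached would lie outside [Omega] by [rho1] and inside by [rho2]. *)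
rewrite a1 scaleN1r in n12; exfalso.
have [U1o _ _ rhoE1] := rhoU1; have [U2o _ _ rhoE2] := rhoU2.
have rho1x : rho1 (x + (0 : R) *: n1) = 0.
  by rewrite scale0r addr0; apply/(proj2 (rhoE1 x U1x)).
have rho2x : rho2 (x + (0 : R) *: n1) = 0.
  by rewrite scale0r addr0; apply/(proj2 (rhoE2 x U2x)).
have drho1 := defining_diff rhoU1 U1x; have drho2 := defining_diff rhoU2 U2x.
have grad_n1 : dot (grad rho1 x) n1 = enorm (grad rho1 x).
  have := enorm_grad_gt0 rhoU1 U1x => g0.
  by rewrite /n1 /unit_grad dotZr -sqr_enorm; field; rewrite gt_eqF.
have grad_n2 : dot (grad rho2 x) n1 = - enorm (grad rho2 x).
  have := enorm_grad_gt0 rhoU2 U2x => g0.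
  by rewrite n12 dotNr /n2 /unit_grad dotZr -sqr_enorm; field; rewrite gt_eqF.
have pos1 := derive_gt0_near (is_derive_comp_line n1 drho1) rho1x.
rewrite diff_grad // grad_n1 in pos1.
have {}pos1 := pos1 (enorm_grad_gt0 rhoU1 U1x).
have pos2 := derive_gt0_near (is_deriveN (is_derive_comp_line n1 drho2)).
rewrite /= !fctE rho2x oppr0 diff_grad // grad_n2 opprK in pos2.
have {}pos2 := pos2 erefl (enorm_grad_gt0 rhoU2 U2x).
have in1 := near_line n1 (open_nbhs_nbhs (conj U1o U1x)).
have in2 := near_line n1 (open_nbhs_nbhs (conj U2o U2x)).
have : \forall s \near (0 : R), ~ 0 < s.
  near=> s => s0; have us1 : U1 (x + s *: n1) by near: s.
  have us2 : U2 (x + s *: n1) by near: s.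
  have p1 : 0 < rho1 (x + s *: n1) by move: s0; near: s.
  have p2 : 0 < - rho2 (x + s *: n1) by move: s0; near: s.
  have /(proj1 (proj1 (rhoE1 _ us1))) : Omega (x + s *: n1).
    by apply/(proj1 (rhoE2 _ us2)); rewrite -oppr_gt0.
  by rewrite ltNge ltW.
move=> /nbhs_ballP[d /= d0 /(_ (d / 2))]; rewrite -ball_normE /= sub0r normrN.
have d20 : 0 < d / 2 by rewrite divr_gt0.
by rewrite gtr0_norm // => hd; apply: (hd _ d20); lra.
Unshelve. all: by end_near. Qed.

Lemma outward_normalE U rho x : A x -> defining_function Omega U rho -> U x ->
  outward_normal Omega x = unit_grad rho x.
Proof.
move=> Ax rhoU Ux; rewrite /outward_normal; case: xgetP => [v _|none].
  by move=> [U' [rho' [rhoU' Ux' ->]]]; exact: unit_grad_unique rhoU' _ rhoU _.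
by exfalso; apply: (none (unit_grad rho x)); exists U, rho.
Qed.

Hypothesis Omega_smooth : smooth_boundary Omega.

Lemma exists_defining_function x : A x -> exists U rho,
  defining_function Omega U rho /\ U x.
Proof.
move=> /Omega_smooth[U [rho [Uo Ux rhoC rho0 rhoE]]]; exists U, rho.
by split=> //; split=> //; exact: (rhoC 2%N).
Qed.

Lemma outward_normal_unit x : A x ->
  dot (outward_normal Omega x) (outward_normal Omega x) = 1.
Proof.
move=> Ax; have [U [rho [rhoU Ux]]] := exists_defining_function Ax.
by rewrite (outward_normalE Ax rhoU Ux) (unit_grad_unit rhoU Ux).
Qed.

Lemma outward_normal_perp x v : A x -> tangent A x v ->
  dot (outward_normal Omega x) v = 0.
Proof.
move=> Ax; have [U [rho [rhoU Ux]]] := exists_defining_function Ax.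
by rewrite (outward_normalE Ax rhoU Ux); exact: (unit_grad_perp rhoU Ux Ax).
Qed.

Lemma outward_normal_C1 : C1_field_on A (outward_normal Omega).
Proof.
move=> x Ax; have [U [rho [rhoU Ux]]] := exists_defining_function Ax.
have [Uo _ _ _] := rhoU.
exists U, (unit_grad rho); split=> // [i|y Ay Uy]; first exact: unit_grad_C1.
exact: (outward_normalE Ay rhoU Uy).
Qed.

End defining_functions.

(** * Transfer of the viscosity inequalities from the surface to the tube *)

Theorem theorem3p3 (R : realType) (n : nat) (n23 : n = 2%N \/ n = 3%N)
  (Omega : set 'rV[R]_n)
  (Omega_open : open Omega) (Omega_bounded : bounded_set Omega)
  (Omega_connected : connected Omega) (Omega_smooth : smooth_boundary Omega)
  (Gamma := boundary Omega) (P := closest_point Gamma)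
  (e : R) (e_gt0 : 0 < e) (e_reach : (e%:E < reach Gamma)%E)
  (P_diff : forall z, tube Gamma e z -> differentiable P z)
  (t : 'rV[R]_n -> 'I_n.-1 -> 'rV[R]_n) (nu : 'rV[R]_n -> 'rV[R]_n)
  (kappa sigma : 'rV[R]_n -> 'I_n.-1 -> R)
  (frame : forall z, tube Gamma e z ->
    principal_frame Omega e z (t z) (nu z) (kappa z) (sigma z))
  (mu : R)
  (B := fun z mu => tensorB (t z) (nu z) (sigma z) mu)
  (T : set 'rV[R]_n) (T_closed : closed T) (T_sub : T `<=` Gamma)
  (f r : 'rV[R]_n -> R)
  (f_lip : [lipschitz f x | x in Gamma]) (r_lip : [lipschitz r x | x in Gamma])
  (F1 F2 R1 R2 : R) (F1_gt0 : 0 < F1) (R1_gt0 : 0 < R1)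
  (f_bnd : forall x, Gamma x -> F1 <= f x <= F2)
  (r_bnd : forall x, Gamma x -> R1 <= r x <= R2)
  (g : 'rV[R]_n -> R) (g_lsc : lower_semicontinuous_on T g)
  (g_min : (ereal_inf [set (g x)%:E | x in T] < +oo)%E)
  (u : 'rV[R]_n -> R) :
  surface_viscosity_solution Gamma T
    (fun x p => r x - f x * enorm p) g u ->
  euclidean_viscosity_solution (tube Gamma e) (tube Gamma e `&` P @^-1` T)
    (fun z p => (r \o P) z - (f \o P) z * enorm (p *m (B z mu)^T))
    (g \o P) (u \o P).
Proof.
have n_gt0 : (0 < n)%N by case: n23 => ->.
have t_orth z (ze : tube Gamma e z) i j : dot (t z i) (t z j) = (i == j)%:R.
  by have [[]] := frame z ze.
have sigma_gt0 z (ze : tube Gamma e z) i : 0 < sigma z i.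
  by have [_ _ _ /(_ i)[]] := frame z ze.
have jacP z (ze : tube Gamma e z) :
    'J P z = \sum_i sigma z i *: tensor (t z i) (t z i).
  by have [] := frame z ze.
have nu_t z (ze : tube Gamma e z) i : dot (nu z) (t z i) = 0.
  by have [[_ tt] [_ nut] _ _ _] := frame z ze; exact: nut.
have t_parallel z (ze : tube Gamma e z) i :
    tangent [set y | dist Gamma y = dist Gamma z] z (t z i).
  have [[_ /(_ i)[gamma [g0 gS dg]]] _ _ _ _] := frame z ze.
  (* Equal signed distances have equal absolute values, so the curve stays in a level set of the
     unsigned distance. *)
  exists gamma; split=> //; apply: filterS gS => s [_ dE].
  by rewrite /= -norm_signed_dist dE norm_signed_dist.
have id_tube x (Gx : Gamma x) : tube Gamma e x by exact: (sub_tube Gx e_gt0).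
have P_id x (Gx : Gamma x) : P x = x by exact: (closest_point_id e_reach e_gt0 Gx).
have t_orthG x (Gx : Gamma x) i j : dot (t x i) (t x j) = (i == j)%:R.
  exact: t_orth (id_tube x Gx) i j.
have t_tangent x i (Gx : Gamma x) : tangent Gamma x (t x i).
  (* A point of [Gamma] is its own foot point, so the frame there is a tangent frame of [Gamma]; the
     outward normal is built from it. *)
  have xe := id_tube x Gx; rewrite -{1}(P_id x Gx).
  exact: (tangent_frame e_reach P_diff t_orth sigma_gt0 jacP).
pose N := outward_normal Omega.
have N_unit x (Gx : Gamma x) : dot (N x) (N x) = 1.
  exact: (outward_normal_unit n_gt0 t_orthG t_tangent Omega_smooth).
have N_perp x v (Gx : Gamma x) (xv : tangent Gamma x v) : dot (N x) v = 0.
  exact: (outward_normal_perp n_gt0 t_orthG t_tangent Omega_smooth).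
have N_C1 : C1_field_on Gamma N.
  exact: (outward_normal_C1 n_gt0 t_orthG t_tangent Omega_smooth).
move=> [u_cont u_T u_sub u_super].
have PG z (ze : tube Gamma e z) : Gamma (P z).
  by have [] := closest_pointP e_reach ze.
have he z (ze : tube Gamma e z) : `|height Gamma N z| < e.
  exact: (height_lt n_gt0 e_reach P_diff t_orth sigma_gt0 jacP N_unit N_perp ze).
have PxN z x (ze : tube Gamma e z) (Gx : Gamma x) :
    P (x + height Gamma N z *: N x) = x.
  exact: (closest_normal_line n_gt0 e_reach P_diff t_orth sigma_gt0 jacP
    N_unit N_perp N_C1 Gx (he z ze)).
have zE z (ze : tube Gamma e z) : P z + height Gamma N z *: N (P z) = z.
  by rewrite -(heightE n_gt0 e_reach P_diff t_orth sigma_gt0 jacP N_unit N_perp ze).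
have psi1 phi z (phi1 : Ck 1 (tube Gamma e) phi) (ze : tube Gamma e z) :
    C1_surface Gamma (fun x => phi (x + height Gamma N z *: N x)).
  exact: (C1_surface_parallel e_reach N_unit N_C1 phi1 (he z ze)).
have near_parallel z (Q : set 'rV[R]_n) (ze : tube Gamma e z) :
    (\forall w \near z, tube Gamma e w -> Q w) ->
    \forall x \near P z, Gamma x -> Q (x + height Gamma N z *: N x).
  move=> zQ; have := parallel_continuous n_gt0 e_reach P_diff t_orth sigma_gt0
    jacP N_unit N_perp N_C1 ze zQ.
  apply: filterS => x h Gx; apply: (h Gx).
  exact: (tube_normal N_unit Gx (he z ze)).
have surf_grad phi z (phi1 : Ck 1 (tube Gamma e) phi) (ze : tube Gamma e z) ext :=
  surface_grad_extremum n_gt0 e_reach P_diff t_orth sigma_gt0 jacP N_unit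
    N_perp N_C1 t_parallel mu phi1 ze (nu_t z ze) ext.
split.
- have u_contP : forall x, Gamma x -> u @ within Gamma (nbhs x) --> u x.
    exact/subspace_continuousP.
  apply/subspace_continuousP => z ze Q uQ.
  have h : nbhs z [set w | Gamma (P w) -> Q (u (P w))].
    (* [u] is continuous only relative to [Gamma]; this suffices since [P] maps the tube into
       [Gamma]. *)
    exact: (differentiable_continuous (P_diff z ze) (u_contP (P z) (PG z ze) Q uQ)).
  suff : nbhs z [set w | tube Gamma e w -> Q (u (P w))] by [].
  by apply: filterS h => w /= hw we; exact: hw (PG w we).
- by move=> z [ze Tz]; exact: u_T.
- move=> phi z phi1 [ze nz] ext.
  have nT : ~ T (P z) by move=> Tz; apply: nz.
  have := u_sub _ (P z) (psi1 phi z phi1 ze) (conj (PG z ze) nT).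
  rewrite (surf_grad phi z phi1 ze); last first.
    have ext' : \forall w \near z, tube Gamma e w ->
      u (P w) - phi w <= u (P z) - phi z by [].
    (* Among points with the foot point of [z] the values of [u] cancel, and a maximum of
       [u \o P - phi] becomes a minimum of [phi]. *)
    left; apply: filterS2 ext' (tube_near e_reach ze) => w ext'w we Pwz.
    by have := ext'w we; rewrite -/P in Pwz; rewrite Pwz lerD2l lerN2.
  (* At the translate of [x] the foot point is [x], so [Q] there states that [u] minus the
     transported test function is at most its value at [P z]. *)
  pose Q := [set w | u (P w) - phi w <= u (P z) - phi z].
  apply; apply: filterS (near_parallel z Q ze ext) => x h Gx.
  by have := h Gx; rewrite /Q /= (PxN z x ze Gx) zE.
- move=> phi z phi1 [ze nz] ext.
  have nT : ~ T (P z) by move=> Tz; apply: nz.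
  have := u_super _ (P z) (psi1 phi z phi1 ze) (conj (PG z ze) nT).
  rewrite (surf_grad phi z phi1 ze); last first.
    have ext' : \forall w \near z, tube Gamma e w ->
      u (P z) - phi z <= u (P w) - phi w by [].
    (* Here the minimum of [u \o P - phi] becomes a maximum of [phi] along the normal line. *)
    right; apply: filterS2 ext' (tube_near e_reach ze) => w ext'w we Pwz.
    by have := ext'w we; rewrite -/P in Pwz; rewrite Pwz lerD2l lerN2.
  pose Q := [set w | u (P z) - phi z <= u (P w) - phi w].
  apply; apply: filterS (near_parallel z Q ze ext) => x h Gx.
  by have := h Gx; rewrite /Q /= (PxN z x ze Gx) zE.
Qed.
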